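(* The Weighted Efficient Domination problem can be solved robustly in time $O(nm)$ on $(P_2+P_4)$-free graphs, where $n$ and $m$ are the numbers of vertices and edges of the input graph.
   Context: All graphs are finite, undirected and simple. A vertex dominates itself and all its neighbors. A vertex set $D$ of $G$ is an efficient dominating set (e.d.) if every vertex of $G$ is dominated by exactly one vertex of $D$. Weighted Efficient Domination: given $G=(V,E)$ and $\omega:V\to\mathbb{N}$, find an e.d. of minimum total weight or determine that none exists. $P_k$ is the chordless path on $k$ vertices and $P_2+P_4$ is the disjoint union of $P_2$ and $P_4$; $(P_2+P_4)$-free means no induced subgraph isomorphic to $P_2+P_4$. An algorithm for a problem on a graph class $\mathcal{C}$ is robust if it accepts an arbitrary graph and either solves the problem correctly or correctly determines that the input is not in $\mathcal{C}$. *)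

(* Defs.v *)
From mathcomp Require Import all_boot.
Set Implicit Arguments. Unset Strict Implicit. Unset Printing Implicit Defensive.

Definition edge_list n := seq ('I_n * 'I_n).

Definition simple_edges n (E : edge_list n) : bool :=
  all (fun e => e.1 != e.2) E && uniq [seq [set e.1; e.2] | e <- E].

Definition adj n (E : edge_list n) (u v : 'I_n) : bool :=
  ((u, v) \in E) || ((v, u) \in E).

Definition dominates n (E : edge_list n) (d v : 'I_n) : bool :=
  (d == v) || adj E d v.

Definition efficient_dom n (E : edge_list n) (D : {set 'I_n}) : Prop :=
  forall v : 'I_n, #|[set d in D | dominates E d v]| = 1.

Definition weight n (w : 'I_n -> nat) (D : {set 'I_n}) : nat :=
  \sum_(d in D) w d.

Definition p2p4_adj (i j : 'I_6) : bool :=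
  let a := minn i j in let b := maxn i j in
  [|| (a == 0) && (b == 1), (a == 2) && (b == 3),
      (a == 3) && (b == 4) | (a == 4) && (b == 5)].

Definition has_induced_P2P4 n (E : edge_list n) : Prop :=
  exists f : 'I_6 -> 'I_n, injective f /\
    forall i j : 'I_6, adj E (f i) (f j) = p2p4_adj i j.

Definition P2P4_free n (E : edge_list n) : Prop := ~ has_induced_P2P4 E.

(* Machine model: a unit-cost RAM with an unbounded memory of natural  *)
(* numbers, addition, truncated subtraction and indirect addressing.   *)

Inductive instr :=
| IConst of nat & nat
| IAdd of nat & nat & nat
| ISub of nat & nat & nat
| ILoad of nat & nat
| IStore of nat & nat
| IJz of nat & nat
| IJmp of nat
| IHalt.

Definition program := seq instr.
Definition memory := nat -> nat.

Definition upd (M : memory) (a x : nat) : memory :=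
  fun i => if i == a then x else M i.

(* one step; None means the machine has halted (Halt, or pc out of range) *)
Definition step (P : program) (pc : nat) (M : memory) : option (nat * memory) :=
  match nth IHalt P pc with
  | IConst a k => Some (pc.+1, upd M a k)
  | IAdd a b c => Some (pc.+1, upd M a (M b + M c))
  | ISub a b c => Some (pc.+1, upd M a (M b - M c))
  | ILoad a b => Some (pc.+1, upd M a (M (M b)))
  | IStore a b => Some (pc.+1, upd M (M a) (M b))
  | IJz a l => Some (if M a == 0 then l else pc.+1, M)
  | IJmp l => Some (l, M)
  | IHalt => None
  end.

Fixpoint run (P : program) (fuel pc : nat) (M : memory) : option memory :=
  match step P pc M with
  | None => Some M
  | Some (pc', M') => if fuel is k.+1 then run P k pc' M' else None
  end.

(* Input encoding of (G, w): the memory initially holds the list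
   [n; m; w(0); ...; w(n-1); u_1; v_1; ...; u_m; v_m]
   starting at address 0 (where {u_j, v_j} is the j-th edge), all other
   cells being 0. *)
Definition input_list n (E : edge_list n) (w : 'I_n -> nat) : seq nat :=
  [:: n; size E] ++ [seq w v | v <- enum 'I_n]
  ++ flatten [seq [:: nat_of_ord e.1; nat_of_ord e.2] | e <- E].

Definition encode n (E : edge_list n) (w : 'I_n -> nat) : memory :=
  fun i => nth 0 (input_list E w) i.

(* Output convention on halting: M[0] is the answer code,
   0 = "D is a minimum weight e.d.", with D = {v | M[1+v] <> 0};
   1 = "G has no e.d.";  2 = "G is not (P2+P4)-free". *)
Definition out_set n (M : memory) : {set 'I_n} := [set v : 'I_n | M v.+1 != 0].

Definition robust_WED_output n (E : edge_list n) (w : 'I_n -> nat) (M : memory) : Prop :=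
  [\/ M 0 = 0 /\ efficient_dom E (out_set n M) /\
        (forall D : {set 'I_n}, efficient_dom E D -> weight w (out_set n M) <= weight w D),
      M 0 = 1 /\ (forall D : {set 'I_n}, ~ efficient_dom E D)
    | M 0 = 2 /\ has_induced_P2P4 E].

(* Main.v *)
Require Import Defs.
From mathcomp Require Import all_boot zify.
Set Implicit Arguments. Unset Strict Implicit. Unset Printing Implicit Defensive.

(* Call v full if no edge leaves N[v], i.e. if v is universal in its component.

   If every component has a full vertex, an e.d. contains exactly one vertex of
   each component and that vertex is full, so a lightest full vertex of each
   component is optimal.

   Otherwise take w of minimum degree among the vertices whose component has no
   full vertex.  An e.d. D contains some v in N[w]; as v is not full, there is an
   induced path v-u-x-d with d in D.  Let Z be the set of vertices not dominated
   by v, u, x, d.  Every member of D other than v and d lies in Z, because u and x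
   are already dominated.  Conversely a vertex of Z without neighbour in Z must
   belong to D.  If Z is independent, D is thus {v, d} + Z; and an edge inside Z
   together with the path is an induced P2 + P4.  For a fixed pair (v, d) a single
   path v-u-x-d suffices.  By minimality of deg w there are at most
   (deg w + 1) |W| <= 4 m pairs, W being the union of the components without full
   vertex.  A pair is handled in time O(n): the vertices of {v, d} + Z are visited
   until the sizes of their closed neighbourhoods add up to more than n.  If no
   visited vertex has a neighbour in Z, all of them are forced into D, and such a
   sum rules D out, because for an e.d. the sum is exactly n.

   The algorithm is written in a small structured language with unbounded arrays,
   which is compiled to the RAM with an exact step count. *)

(** * A structured language and its compilation to the RAM *)

(** The time bound leaves no room for n^2 work when m is small, yet adjacency must be tested in
    constant time. The n by n domination matrix is affordable because untouched memory is zero: only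
    its diagonal and two entries per edge are ever written. The RAM has no multiplication, hence a
    table of row offsets.

    Freeness is never tested for its own sake. The only certificate of an induced P2 + P4 is a
    visited vertex with a neighbour in Z, and once found it settles the answer. An edge of Z between
    unvisited vertices may go unnoticed, which is harmless: as long as no visited vertex has a
    neighbour in Z, no e.d. other than {v, d} + Z can contain both v and d. One path per pair
    suffices because the argument about an e.d. containing v and d works with any path.

    Recomputing the distance levels costs O(n + m) for each v in N[w]; this stays within the bound
    because deg w < n and deg w <= 2 m. *)

Inductive expr :=
| EVar of nat
| EConst of nat
| EAdd of expr & expr
| ESub of expr & expr
| EArr of nat & expr.

Inductive cmd :=
| CSet of nat & expr
| CPut of nat & expr & expr
| CSeq of cmd & cmd
| CIf of expr & cmd & cmd
| CFor of nat & expr & cmd.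

Record state := State { reg : nat -> nat; arr : nat -> nat -> nat }.

Definition setr x a s := State (upd (reg s) x a) (arr s).
Definition seta t i a s :=
  State (reg s) (fun t' => if t' == t then upd (arr s t) i a else arr s t').

Fixpoint eval s e :=
  match e with
  | EVar x => reg s x
  | EConst k => k
  | EAdd e1 e2 => eval s e1 + eval s e2
  | ESub e1 e2 => eval s e1 - eval s e2
  | EArr t e1 => arr s t (eval s e1)
  end.

Fixpoint exec c s :=
  match c with
  | CSet x e => setr x (eval s e) s
  | CPut t e1 e2 => seta t (eval s e1) (eval s e2) s
  | CSeq c1 c2 => exec c2 (exec c1 s)
  | CIf e c1 c2 => if eval s e == 0 then exec c2 s else exec c1 s
  | CFor x e c1 => iteri (eval s e) (fun k s => exec c1 (setr x k s)) s
  end.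

Fixpoint esize e :=
  match e with
  | EVar _ | EConst _ => 1
  | EAdd e1 e2 | ESub e1 e2 => esize e1 + esize e2 + 1
  | EArr _ e1 => esize e1 + 8
  end.

Fixpoint cost c s :=
  match c with
  | CSet _ e => esize e + 1
  | CPut _ e1 e2 => esize e1 + 7 + esize e2 + 1
  | CSeq c1 c2 => cost c1 s + cost c2 (exec c1 s)
  | CIf e c1 c2 => esize e + 1 + (if eval s e == 0 then cost c2 s else cost c1 s + 1)
  | CFor x e c1 => esize e + 3 +
     \sum_(k < eval s e)
       (6 + cost c1 (setr x k (iteri k (fun k s => exec c1 (setr x k s)) s)))
  end.

(* Cells 0 and 1 are scratch, cell 2 holds 0, cell 3 the base of the arrays;
   then 40 variables, 8 pairs of loop counters and 30 temporaries.  The 16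
   unbounded arrays are interleaved above the base, so that they never need
   a size and never overlap. *)
Definition vreg x := 4 + x.
Definition hreg d := 44 + d.
Definition treg k := 60 + k.
Notation nregs := 90.

(** Four doublings replace the multiplication of the index by 16, the number of interleaved
    arrays. *)
Definition addr_code k t :=
  [:: IAdd (treg k) (treg k) (treg k); IAdd (treg k) (treg k) (treg k);
      IAdd (treg k) (treg k) (treg k); IAdd (treg k) (treg k) (treg k);
      IConst (treg k.+1) t; IAdd (treg k) (treg k) (treg k.+1);
      IAdd (treg k) (treg k) 3].

Fixpoint ecode k e :=
  match e with
  | EVar x => [:: IAdd (treg k) (vreg x) 2]
  | EConst a => [:: IConst (treg k) a]
  | EAdd e1 e2 => ecode k e1 ++ ecode k.+1 e2 ++ [:: IAdd (treg k) (treg k) (treg k.+1)]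
  | ESub e1 e2 => ecode k e1 ++ ecode k.+1 e2 ++ [:: ISub (treg k) (treg k) (treg k.+1)]
  | EArr t e1 => ecode k e1 ++ addr_code k t ++ [:: ILoad (treg k) (treg k)]
  end.

Fixpoint csize c :=
  match c with
  | CSet _ e => esize e + 1
  | CPut _ e1 e2 => esize e1 + 7 + esize e2 + 1
  | CSeq c1 c2 => csize c1 + csize c2
  | CIf e c1 c2 => esize e + 1 + csize c1 + 1 + csize c2
  | CFor _ e c1 => esize e + 4 + csize c1 + 4
  end.

(** Jumps are absolute, so the code depends on its position [pc]. A loop at depth [d] keeps the
    iterations left in [hreg d.*2] and those done in [hreg d.*2.+1]; the program variable [x] is
    only a copy, so the body may overwrite it. *)
Fixpoint ccode pc d c :=
  match c with
  | CSet x e => ecode 0 e ++ [:: IAdd (vreg x) (treg 0) 2]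
  | CPut t e1 e2 => ecode 0 e1 ++ addr_code 0 t ++ ecode 1 e2 ++ [:: IStore (treg 0) (treg 1)]
  | CSeq c1 c2 => ccode pc d c1 ++ ccode (pc + csize c1) d c2
  | CIf e c1 c2 =>
      let p1 := pc + esize e + 1 in
      let p2 := p1 + csize c1 + 1 in
      ecode 0 e ++ [:: IJz (treg 0) p2] ++ ccode p1 d c1 ++
      [:: IJmp (p2 + csize c2)] ++ ccode p2 d c2
  | CFor x e c1 =>
      let p1 := pc + esize e + 2 in
      let p2 := p1 + 2 + csize c1 in
      ecode 0 e ++ [:: IAdd (hreg d.*2) (treg 0) 2; IConst (hreg d.*2.+1) 0;
                       IJz (hreg d.*2) (p2 + 4); IAdd (vreg x) (hreg d.*2.+1) 2] ++
      ccode (p1 + 2) d.+1 c1 ++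
      [:: IConst (treg 0) 1; IAdd (hreg d.*2.+1) (hreg d.*2.+1) (treg 0);
          ISub (hreg d.*2) (hreg d.*2) (treg 0); IJmp p1]
  end.

(** The bound 29 leaves room for [treg k.+1], the second temporary of [addr_code], below [nregs]. *)
Fixpoint ewf k e :=
  match e with
  | EVar x => (k < 29) && (x < 40)
  | EConst _ => k < 29
  | EAdd e1 e2 | ESub e1 e2 => ewf k e1 && ewf k.+1 e2
  | EArr t e1 => ewf k e1 && (t < 16)
  end.

Fixpoint cwf d c :=
  match c with
  | CSet x e => ewf 0 e && (x < 40)
  | CPut t e1 e2 => [&& ewf 0 e1, ewf 1 e2 & t < 16]
  | CSeq c1 c2 => cwf d c1 && cwf d c2
  | CIf e c1 c2 => [&& ewf 0 e, cwf d c1 & cwf d c2]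
  | CFor x e c1 => [&& ewf 0 e, x < 40, d < 8 & cwf d.+1 c1]
  end.

Lemma size_ecode k e : size (ecode k e) = esize e.
Proof.
elim: e k => //= [e1 h1 e2 h2|e1 h1 e2 h2|t e1 h1] k;
by rewrite !size_cat /= ?h1 ?h2; lia.
Qed.

Lemma size_ccode pc d c : size (ccode pc d c) = csize c.
Proof.
elim: c pc d => /= [x e|t e1 e2|c1 h1 c2 h2|e c1 h1 c2 h2|x e c1 h1] pc d;
by rewrite !size_cat /= ?size_cat /= ?size_ecode ?h1 ?h2 /=; lia.
Qed.

(** * Correctness of the compiler, with exact step counts *)

Definition effect i (M : memory) : memory :=
  match i with
  | IConst a k => upd M a k
  | IAdd a b c => upd M a (M b + M c)
  | ISub a b c => upd M a (M b - M c)
  | ILoad a b => upd M a (M (M b))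
  | IStore a b => upd M (M a) (M b)
  | _ => M
  end.

Definition straight i :=
  match i with IJz _ _ | IJmp _ | IHalt => false | _ => true end.

Definition effects l M := foldl (fun M i => effect i M) M l.

(** Unlike [run], which asks for halting within the fuel, this performs exactly [t] steps, so that
    runs compose by adding their lengths. *)
Fixpoint steps P t pc (M : memory) : option (nat * memory) :=
  if t is k.+1 then
    if step P pc M is Some (pc', M') then steps P k pc' M' else None
  else Some (pc, M).

Lemma steps_cat P t1 t2 pc M pc1 M1 :
  steps P t1 pc M = Some (pc1, M1) -> steps P (t1 + t2) pc M = steps P t2 pc1 M1.
Proof.
elim: t1 pc M => [|t1 IH] pc M /=; first by case=> -> ->.
by case: (step P pc M) => // -[pc' M'] /IH.
Qed.

Lemma run_steps P t f pc M pc1 M1 :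
  steps P t pc M = Some (pc1, M1) -> run P (t + f) pc M = run P f pc1 M1.
Proof.
elim: t pc M => [|t IH] pc M /=; first by case=> -> ->.
by case: (step P pc M) => // -[pc' M'] /IH.
Qed.

Definition code_at (P : program) pc l := forall i, i < size l -> nth IHalt P (pc + i) = nth IHalt l i.

Lemma code_at_cat P pc l1 l2 :
  code_at P pc (l1 ++ l2) -> code_at P pc l1 /\ code_at P (pc + size l1) l2.
Proof.
move=> h; split=> i hi.
  by rewrite h ?nth_cat ?hi // size_cat; lia.
rewrite -addnA h ?size_cat ?ltn_add2l // nth_cat ifF; last by lia.
by congr nth; lia.
Qed.

Lemma code_at_cons P pc i l :
  code_at P pc (i :: l) -> nth IHalt P pc = i /\ code_at P pc.+1 l.
Proof.
move=> h; split; first by have := h 0 isT; rewrite addn0.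
by move=> j hj; have := h j.+1 hj; rewrite addnS.
Qed.

Lemma steps_straight P pc l M :
  all straight l -> code_at P pc l ->
  steps P (size l) pc M = Some (pc + size l, effects l M).
Proof.
elim: l pc M => [|i l IH] pc M /=; first by rewrite addn0.
case/andP=> hi hl /code_at_cons[h1 h2].
rewrite /step h1 -addSnnS.
by case: i hi h1 => //= *; rewrite IH.
Qed.

Lemma straight_ecode k e : all straight (ecode k e).
Proof. by elim: e k => //= *; rewrite !all_cat /=; do ?[apply/andP; split]. Qed.

Definition represents (M : memory) s :=
  [/\ M 2 = 0, nregs <= M 3, forall x, x < 40 -> M (vreg x) = reg s x &
      forall t i, t < 16 -> M (M 3 + 16 * i + t) = arr s t i].

(** The other cells are the loop counters and temporaries, which [represents] never reads. *)
Definition protected a := a < hreg 0 \/ nregs <= a.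

Lemma rel_ext M M' s : represents M s -> (forall a, protected a -> M' a = M a) -> represents M' s.
Proof.
rewrite /protected /hreg; move=> [h1 h2 h3 h4] h; split.
- by rewrite h //; left.
- by rewrite h //; left.
- by move=> x hx; rewrite h ?h3 // /vreg; left; lia.
- move=> t i ht; rewrite (h 3); last by left.
  by rewrite h ?h4 //; right; lia.
Qed.

Arguments effects : simpl never.

Lemma effects_cat l1 l2 M : effects (l1 ++ l2) M = effects l2 (effects l1 M).
Proof. exact: foldl_cat. Qed.

Lemma effects1 i M : effects [:: i] M = effect i M.
Proof. by []. Qed.

Lemma updE M a x : upd M a x a = x.
Proof. by rewrite /upd eqxx. Qed.

Lemma updN M a x b : b <> a -> upd M a x b = M b.
Proof. by rewrite /upd => /eqP /negbTE ->. Qed.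

Lemma effects_addr k t M : 2 < treg k ->
  [/\ effects (addr_code k t) M (treg k) = M 3 + 16 * M (treg k) + t &
      forall a, a < treg k \/ nregs <= a -> k < 29 -> effects (addr_code k t) M a = M a].
Proof.
rewrite /treg => hk; split.
  cbv [effects addr_code foldl effect treg].
  rewrite !(updE, @updN _ (60 + k) _ (60 + k.+1), @updN _ (60 + k.+1) _ (60 + k), @updN _ (60+k) _ 3, @updN _ (60+k.+1) _ 3); lia.
move=> a ha hk2; cbv [effects addr_code foldl effect treg].
by rewrite !updN //; lia.
Qed.

Lemma ewf_lt k e : ewf k e -> k < 29.
Proof.
by elim: e k => [x|a|a h1 b h2|a h1 b h2|t a h1] k //=; case/andP => // h3 *; exact: h1.
Qed.

(** The induction step shared by addition and subtraction: the value of [e1] survives in [treg k]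
    because [e2] is evaluated in higher temporaries only. *)
Lemma effects_binop M s k e1 e2 i (v := effects (ecode k.+1 e2) (effects (ecode k e1) M)) :
  represents M s -> ewf k e1 && ewf k.+1 e2 ->
  (forall k M, represents M s -> ewf k e1 -> effects (ecode k e1) M (treg k) = eval s e1 /\
    (forall a, a < treg k \/ nregs <= a -> effects (ecode k e1) M a = M a)) ->
  (forall k M, represents M s -> ewf k e2 -> effects (ecode k e2) M (treg k) = eval s e2 /\
    (forall a, a < treg k \/ nregs <= a -> effects (ecode k e2) M a = M a)) ->
  effects (ecode k e1 ++ ecode k.+1 e2 ++ [:: i]) M = effect i v /\
  [/\ v (treg k) = eval s e1, v (treg k.+1) = eval s e2 &
      forall a b, a < treg k \/ nregs <= a -> upd v (treg k) b a = M a].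
Proof.
move=> hM /andP[w1 w2] IH1 IH2; rewrite !effects_cat; split=> //.
have [v1 f1] := IH1 _ _ hM w1.
have hM1 : represents (effects (ecode k e1) M) s.
  apply: (rel_ext hM) => a; rewrite /protected /hreg => ha.
  by apply: f1; rewrite /treg; lia.
have [v2 f2] := IH2 _ _ hM1 w2; have hk := ewf_lt w1; rewrite /v; split=> //.
  by rewrite f2 // /treg; left; lia.
move=> a b ha; rewrite updN; last by move: ha; rewrite /treg; lia.
by rewrite f2 ?f1 //; move: ha; rewrite /treg; lia.
Qed.

Lemma ecode_ok M s k e : represents M s -> ewf k e ->
  effects (ecode k e) M (treg k) = eval s e /\
  (forall a, a < treg k \/ nregs <= a -> effects (ecode k e) M a = M a).
Proof.
elim: e k M => [x|a|e1 IH1 e2 IH2|e1 IH1 e2 IH2|t e1 IH1] k M hM.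
- case/andP => hk hx; case: (hM) => h2 h3 hv ha.
  rewrite effects1 [effect _ _]/= updE h2 hv // addn0; split=> // a ha'; rewrite updN //.
  by move: ha' hk; rewrite /treg; lia.
- move=> hk; rewrite effects1 [effect _ _]/= updE; split=> // b hb; rewrite updN //.
  by move: hb hk; rewrite /treg /=; lia.
- move=> we; have [-> [/= -> -> f]] := effects_binop (IAdd (treg k) (treg k) (treg k.+1)) hM we IH1 IH2.
  by rewrite updE; split=> // a; apply: f.
- move=> we; have [-> [/= -> -> f]] := effects_binop (ISub (treg k) (treg k) (treg k.+1)) hM we IH1 IH2.
  by rewrite updE; split=> // a; apply: f.
- case/andP => w1 ht; rewrite !effects_cat.
  have [v1 f1] := IH1 _ _ hM w1; have hk := ewf_lt w1.
  have [v2 f2] := @effects_addr k t (effects (ecode k e1) M) isT.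
  case: (hM) => _ h3 _ ha.
  rewrite effects1 [effect _ _]/= updE v2 v1.
  have e3 : effects (ecode k e1) M 3 = M 3 by apply: f1; left.
  rewrite f2 //; last by right; lia.
  rewrite e3 f1; last by right; lia.
  split; first exact: ha.
  move=> a hha; rewrite updN; last by move: hha hk; rewrite /treg; lia.
  by rewrite f2 ?f1.
Qed.

Lemma rel_setr M s x a : represents M s -> x < 40 -> represents (upd M (vreg x) a) (setr x a s).
Proof.
rewrite /vreg; case=> h1 h2 h3 h4 hx; split.
- by rewrite updN //; lia.
- by rewrite updN //; lia.
- move=> y hy; rewrite /upd /= /upd /vreg eqn_add2l.
  by case: eqP => // _; apply: h3.
- move=> t i ht; rewrite (@updN _ _ _ 3); last by lia.
  by rewrite updN ?h4 //; lia.
Qed.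

Lemma rel_seta M s t i a : represents M s -> t < 16 ->
  represents (upd M (M 3 + 16 * i + t) a) (seta t i a s).
Proof.
case=> h1 h2 h3 h4 ht; split.
- by rewrite updN //; lia.
- by rewrite updN //; lia.
- by move=> x hx; rewrite updN ?h3 // /vreg; lia.
- move=> t' i' ht'; rewrite (@updN _ _ _ 3); last by lia.
  rewrite /= /upd; case: (altP (t' =P t)) => [->|nt].
    by rewrite eqn_add2r eqn_add2l eqn_pmul2l //; case: eqP => // _; apply: h4.
  rewrite ifF ?h4 //; apply/eqP => e; move/eqP: nt; lia.
Qed.

Lemma steps_ecode P pc M s k e : represents M s -> ewf k e -> code_at P pc (ecode k e) ->
  exists M', [/\ steps P (esize e) pc M = Some (pc + esize e, M'),
    M' (treg k) = eval s e & forall a, a < treg k \/ nregs <= a -> M' a = M a].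
Proof.
move=> hM we /(steps_straight M (straight_ecode k e)); rewrite size_ecode => hs.
have [v f] := ecode_ok hM we.
by exists (effects (ecode k e) M).
Qed.

Lemma rel_temp M M' s : represents M s -> (forall a, a < treg 0 \/ nregs <= a -> M' a = M a) -> represents M' s.
Proof.
move=> hM h; apply: (rel_ext hM) => a; rewrite /protected /hreg => ha.
by apply: h; rewrite /treg; lia.
Qed.

Lemma steps1 P pc M : steps P 1 pc M = step P pc M.
Proof. by rewrite /=; case: (step P pc M) => // -[]. Qed.

Lemma steps_seq P t1 t2 pc M pc1 M1 pc2 M2 :
  steps P t1 pc M = Some (pc1, M1) -> steps P t2 pc1 M1 = Some (pc2, M2) ->
  steps P (t1 + t2) pc M = Some (pc2, M2).
Proof. by move=> h1 h2; rewrite (steps_cat _ h1). Qed.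

(** The last two clauses strengthen the induction: an inner command must preserve the counters of
    all enclosing loops, and the fixed array base is needed again when the output is written. *)
Lemma ccode_ok P c d pc M s : d <= 8 -> cwf d c -> code_at P pc (ccode pc d c) -> represents M s ->
  exists M', [/\ steps P (cost c s) pc M = Some (pc + csize c, M'), represents M' (exec c s), M' 3 = M 3 &
    forall h, h < d.*2 -> M' (hreg h) = M (hreg h)].
Proof.
elim: c d pc M s => [x e|t e1 e2|c1 IH1 c2 IH2|e c1 IH1 c2 IH2|x e c1 IH1] d pc M s hd.
- case/andP=> we wx hc hM.
  have [h1 h2] := code_at_cat hc.
  have [M1 [r1 v1 f1]] := steps_ecode hM we h1.
  have hM1 := rel_temp hM f1.
  have [h21 _] := code_at_cons h2; rewrite size_ecode in h21.
  exists (upd M1 (vreg x) (eval s e)); split.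
  + apply: (steps_seq r1); rewrite steps1 /step h21 v1.
    by case: hM1 => -> _ _ _; rewrite addn0; congr (Some (_, _)); rewrite /=; lia.
  + exact: rel_setr.
  + by rewrite updN ?f1 //; left.
  + by move=> h hh; rewrite updN ?f1 //; rewrite /hreg /treg /vreg; lia.
- case/and3P=> w1 w2 ht.
  case/(@code_at_cat _ _ (ecode 0 e1))=> h1 /(@code_at_cat _ _ (addr_code 0 t))[ha].
  case/(@code_at_cat _ _ (ecode 1 e2))=> h2 /code_at_cons[hs _] hM.
  rewrite ?size_ecode [size (addr_code _ _)]/= in ha h2 hs.
  have [M1 [r1 v1 f1]] := steps_ecode hM w1 h1.
  have hM1 := rel_temp hM f1.
  have := steps_straight M1 _ ha; set M2 := effects _ M1 => /(_ isT) ra.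
  have [v2 f2] := @effects_addr 0 t M1 isT.
  have hM2 : represents M2 s by apply: (rel_temp hM1) => a hha; exact: f2.
  have [M3 [r3 v3 f3]] := steps_ecode hM2 w2 h2.
  have hM3 : represents M3 s.
    by apply: (rel_temp hM2) => a hha; apply: f3; rewrite /treg in hha *; lia.
  have e3 : M1 3 = M3 3.
    by rewrite f3 /M2 ?f2 //; left.
  exists (upd M3 (M3 3 + 16 * eval s e1 + t) (eval s e2)); split.
  + rewrite [cost _ _]/= [csize _]/= -!addnA; apply: (steps_seq r1); apply: (steps_seq ra); apply: (steps_seq r3).
    rewrite steps1 /step hs v3 f3; last by left.
    rewrite /M2 v2 v1 e3; congr (Some (_, upd _ _ _)); rewrite /=; lia.
  + exact: rel_seta.
  + case: (hM3) => _ ? _ _; rewrite updN; [rewrite -e3 f1 //; by left | lia].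
  + move=> h hh; case: (hM3) => _ ? _ _.
    rewrite updN; last by rewrite /hreg; lia.
    have hl : hreg h < 60 by rewrite /hreg; lia.
    rewrite f3; last by left; rewrite /treg; lia.
    by rewrite /M2 f2 ?f1 //; left.
- case/andP=> w1 w2 /(@code_at_cat _ _ (ccode pc d c1))[h1 h2] hM; rewrite size_ccode in h2.
  have [M1 [r1 hM1 b1 f1]] := IH1 _ _ _ _ hd w1 h1 hM.
  have [M2 [r2 hM2 b2 f2]] := IH2 _ _ _ _ hd w2 h2 hM1.
  exists M2; split=> //; [|by rewrite b2|by move=> h hh; rewrite f2 ?f1].
  by rewrite /= (steps_seq r1 r2) addnA.
- case/and3P=> we w1 w2 /(@code_at_cat _ _ (ecode 0 e))[he] /= /code_at_cons[hz /code_at_cat[h1 /code_at_cons[hj h2]]] hM.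
  rewrite size_ecode size_ccode in hz h1 hj h2.
  have [M0 [r0 v0 f0]] := steps_ecode hM we he.
  have hM0 := rel_temp hM f0.
  have b0 : M0 3 = M 3 by rewrite f0 //; left.
  have f0' h : h < d.*2 -> M0 (hreg h) = M (hreg h).
    by move=> hh; rewrite f0 // /hreg /treg; left; lia.
  case: ifP => e0.
  + have h2' : code_at P (pc + esize e + 1 + csize c1 + 1) (ccode (pc + esize e + 1 + csize c1 + 1) d c2).
      by congr code_at: h2; lia.
    have [M2 [r2 hM2 b2 f2]] := IH2 _ _ _ _ hd w2 h2' hM0.
    exists M2; split=> //; [|by rewrite b2 b0|by move=> h hh; rewrite f2 ?f0'].
    rewrite -!addnA; apply: (steps_seq r0); rewrite (steps_seq (t1 := 1) _ r2) //.
      by congr (Some (_, _)); lia.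
    by rewrite steps1 /step hz v0 e0.
  + have h1' : code_at P (pc + esize e + 1) (ccode (pc + esize e + 1) d c1).
      by congr code_at: h1; lia.
    have [M1 [r1 hM1 b1 f1]] := IH1 _ _ _ _ hd w1 h1' hM0.
    exists M1; split=> //; [|by rewrite b1 b0|by move=> h hh; rewrite f1 ?f0'].
    rewrite -!addnA; apply: (steps_seq r0).
    apply: (steps_seq (pc1 := pc + esize e + 1) (M1 := M0)).
      by rewrite steps1 /step hz v0 e0 addn1.
    apply: (steps_seq r1); rewrite steps1 /step.
    rewrite (_ : pc + esize e + 1 + csize c1 = (pc + esize e).+1 + csize c1) ?hj; last lia.
    by congr (Some (_, _)); lia.
- case/and4P=> we wx hd8 w1 /(@code_at_cat _ _ (ecode 0 e))[he] /= /code_at_cons[i1 /code_at_cons[i2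
    /code_at_cons[i3 /code_at_cons[i4 /code_at_cat[h1 /code_at_cons[j1 /code_at_cons[j2
    /code_at_cons[j3 /code_at_cons[j4 _]]]]]]]]] hM.
  rewrite size_ecode in i1 i2 i3 i4 h1 j1 j2 j3 j4; rewrite size_ccode in j1 j2 j3 j4.
  have [M0 [r0 v0 f0]] := steps_ecode hM we he.
  have hM0 := rel_temp hM f0.
  have b0 : M0 3 = M 3 by rewrite f0 //; left.
  pose p1 := pc + esize e + 2; pose q := p1 + 2 + csize c1.
  have h1' : code_at P (p1 + 2) (ccode (p1 + 2) d.+1 c1) by congr code_at: h1; rewrite /p1; lia.
  set N := eval s e in v0 *; pose F k s0 := exec c1 (setr x k s0).
  rewrite -/F.
  (* Invariant at the loop head [p1], before the test; the two hidden counters add up to [N]. *)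
  have loop k : k <= N -> exists M', [/\
      steps P (esize e + 2 + \sum_(i < k) (6 + cost c1 (setr x i (iteri i F s)))) pc M = Some (p1, M'),
      represents M' (iteri k F s), M' (hreg d.*2) = N - k, M' (hreg d.*2.+1) = k &
      M' 3 = M 3 /\
      forall h, h < d.*2 -> M' (hreg h) = M (hreg h)].
    elim: k => [|k IHk] hk.
      exists (upd (upd M0 (hreg d.*2) N) (hreg d.*2.+1) 0); split.
      + rewrite big_ord0 addn0; apply: (steps_seq r0).
        rewrite /= /step i1 i2; case: (hM0) => -> _ _ _; rewrite addn0 v0 /p1.
        by rewrite addn2.
      + apply: (rel_ext hM0) => a; rewrite /protected /hreg => ha.
        by rewrite !updN //; lia.
      + by rewrite updN ?updE ?subn0 // /hreg; lia.
      + by rewrite updE.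
      + split; first by rewrite !updN ?b0 // /hreg; lia.
        by move=> h hh; rewrite !updN ?f0 // /hreg /treg; try left; lia.
    have [M1 [r1 hM1 c1a c1b [b1 f1]]] := IHk (ltnW hk).
    have hM1' : represents (upd M1 (vreg x) k) (setr x k (iteri k F s)) by exact: rel_setr.
    have [M2 [r2 hM2 b2 f2]] := IH1 _ _ _ _ hd8 w1 h1' hM1'.
    have f2' h : h < d.+1.*2 -> M2 (hreg h) = M1 (hreg h).
      by move=> hh; rewrite f2 // updN // /hreg /vreg; lia.
    exists (upd (upd (upd M2 (treg 0) 1) (hreg d.*2.+1) k.+1) (hreg d.*2) (N - k.+1)); split.
    + rewrite big_ord_recr /= addnA; apply: (steps_seq r1).
      rewrite (_ : 6 + _ = 2 + (cost c1 (setr x k (iteri k F s)) + 4)); last lia.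
      apply: (steps_seq (pc1 := p1 + 2) (M1 := upd M1 (vreg x) k)).
        rewrite /= /step /p1.
        rewrite (_ : pc + esize e + 2 = (pc + esize e).+2) ?i3 ?c1a; last lia.
        rewrite ifF; last by lia.
        rewrite i4 c1b; case: (hM1) => -> _ _ _; rewrite addn0; congr (Some (_, _)); lia.
      apply: (steps_seq r2).
      have e1 : p1 + 2 + csize c1 = (pc + esize e).+4 + csize c1 by rewrite /p1; lia.
      rewrite e1 /= /step j1 j2 j3 j4.
      rewrite !(updE, @updN _ (treg 0) _ (hreg _)) ?(@updN _ (hreg d.*2.+1) _ (hreg d.*2)) ?(@updN _ (hreg d.*2.+1) _ (treg 0)) ?updE ?updN //; try by rewrite /hreg /treg; lia.
      by rewrite !f2' ?c1a ?c1b ?addn1 ?subn1 ?subnS //; lia.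
    + rewrite /= -/(F k _); apply: (rel_ext hM2) => a; rewrite /protected /hreg => ha.
      by rewrite !updN // /treg; lia.
    + by rewrite updE.
    + by rewrite updN ?updE // /hreg; lia.
    + split; first by rewrite !updN ?b2 ?updN ?b1 // /hreg /treg /vreg; lia.
      by move=> h hh; rewrite !updN ?f2' ?f1 // /hreg /treg; lia.
  have [M1 [r1 hM1 c1a c1b [b1 f1]]] := loop N (leqnn N).
  exists M1; split=> //.
  rewrite (_ : forall c, esize e + 3 + c = esize e + 2 + c + 1); last by move=> ?; lia.
  apply: (steps_seq r1); rewrite steps1 /step /p1.
  rewrite (_ : pc + esize e + 2 = (pc + esize e).+2) ?i3 ?c1a ?subnn; last lia.
  by congr (Some (_, _)); lia.
Qed.

(** * Frame property and loop rules of the structured language *)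

Fixpoint rmod c :=
  match c with
  | CSet x _ => [:: x]
  | CPut _ _ _ => [::]
  | CSeq c1 c2 | CIf _ c1 c2 => rmod c1 ++ rmod c2
  | CFor x _ c1 => x :: rmod c1
  end.

Fixpoint amod c :=
  match c with
  | CSet _ _ => [::]
  | CPut t _ _ => [:: t]
  | CSeq c1 c2 | CIf _ c1 c2 => amod c1 ++ amod c2
  | CFor _ _ c1 => amod c1
  end.

(** The modified sets are syntactic, so each claim that a variable or array is untouched reduces to
    a computed membership test. *)
Definition frame c s s' :=
  (forall x, x \notin rmod c -> reg s' x = reg s x) /\
  (forall t, t \notin amod c -> arr s' t = arr s t).

Lemma exec_frame c s : frame c s (exec c s).
Proof.
rewrite /frame; elim: c s => [x e|t e1 e2|c1 IH1 c2 IH2|e c1 IH1 c2 IH2|x e c1 IH1] s /=.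
- by split=> // y; rewrite inE => /negbTE hy; rewrite /upd hy.
- by split=> // y; rewrite inE => /negbTE ->.
- have [r1 a1] := IH1 s; have [r2 a2] := IH2 (exec c1 s).
  by split=> y; rewrite mem_cat negb_or => /andP[h1 h2]; rewrite ?r2 ?r1 ?a2 ?a1.
- have [r1 a1] := IH1 s; have [r2 a2] := IH2 s.
  by split=> y; rewrite mem_cat negb_or => /andP[h1 h2]; case: ifP => _; rewrite ?r2 ?r1 ?a2 ?a1.
- elim: (eval s e) => [//|k [r a]] /=.
  set s1 := iteri k _ s in r a *.
  have [r1 a1] := IH1 (setr x k s1).
  split=> y hy; last by rewrite a1 //= a.
  move: (hy); rewrite inE negb_or => /andP[/negbTE hx hc].
  by rewrite r1 //= /upd hx r.
Qed.

(** The invariant carries the accumulated cost [t] of the bodies, which allows amortised bounds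
    depending on the state; the frame of the whole loop comes for free at each iteration. *)
Lemma for_rule x e c s (J : nat -> nat -> state -> Prop) :
  J 0 0 s ->
  (forall k t s', k < eval s e -> frame (CFor x e c) s s' -> J k t s' ->
     J k.+1 (t + cost c (setr x k s')) (exec c (setr x k s'))) ->
  exists t, J (eval s e) t (exec (CFor x e c) s) /\
            cost (CFor x e c) s = esize e + 3 + 6 * eval s e + t.
Proof.
pose F (k : nat) s0 := exec c (setr x k s0).
move=> J0 Jk /=; rewrite -/F.
have fr k : frame (CFor x e c) s (iteri k F s).
  (* The first [k] iterations are themselves a loop, with a constant bound. *)
  have := exec_frame (CFor x (EConst k) c) s; rewrite [exec _ _]/= -/F.
  by rewrite /frame.
have loop k : k <= eval s e ->
  J k (\sum_(i < k) cost c (setr x i (iteri i F s))) (iteri k F s).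
  elim: k => [|k IH] hk; first by rewrite big_ord0.
  by rewrite big_ord_recr /=; apply: Jk => //; apply: IH; apply: ltnW.
exists (\sum_(i < eval s e) cost c (setr x i (iteri i F s))); split; first exact: loop.
by rewrite big_split /= sum_nat_const card_ord mulnC addnA.
Qed.

Fixpoint loop_free c :=
  match c with
  | CSet _ _ | CPut _ _ _ => true
  | CSeq c1 c2 | CIf _ c1 c2 => loop_free c1 && loop_free c2
  | CFor _ _ _ => false
  end.

(** A true bound only for loop-free code. On a loop it is a constant to be multiplied by an
    iteration count; its 9 is the entry and exit overhead 3 plus the overhead 6 per iteration. *)
Fixpoint max_cost c :=
  match c with
  | CSet _ e => esize e + 1
  | CPut _ e1 e2 => esize e1 + 7 + esize e2 + 1
  | CSeq c1 c2 => max_cost c1 + max_cost c2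
  | CIf e c1 c2 => esize e + 2 + max_cost c1 + max_cost c2
  | CFor _ e c1 => esize e + 9 + max_cost c1
  end.

Lemma cost_loop_free c s : loop_free c -> cost c s <= max_cost c.
Proof.
elim: c s => [x e|t e1 e2|c1 IH1 c2 IH2|e c1 IH1 c2 IH2|x e c1 IH1] //= s /andP[h1 h2].
- by rewrite leq_add ?IH1 ?IH2.
- by have := IH1 s h1; have := IH2 s h2; case: ifP => _; lia.
Qed.

Lemma for_loop_free x e c s (J : nat -> state -> Prop) :
  loop_free c -> J 0 s ->
  (forall k s', k < eval s e -> frame (CFor x e c) s s' -> J k s' ->
     J k.+1 (exec c (setr x k s'))) ->
  J (eval s e) (exec (CFor x e c) s) /\
  cost (CFor x e c) s <= max_cost (CFor x e c) * (eval s e).+1.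
Proof.
move=> hc J0 Jk.
have [||t [[Jt ht] ->]] := @for_rule x e c s (fun k t s => J k s /\ t <= max_cost c * k).
- by rewrite muln0.
- move=> k t s' hk fr [Jks ht]; split; first exact: Jk.
  by rewrite mulnS addnC leq_add ?cost_loop_free.
by split=> //=; nia.
Qed.

(* With the base [96 n + 64 m] the arrays start beyond the input as soon as
   [n > 0], and [m] can be recovered from [n] and the base. *)
Definition prologue_init :=
  [:: IAdd 1 0 1; IAdd 1 1 1; IAdd 1 1 0;
      IAdd 1 1 1; IAdd 1 1 1; IAdd 1 1 1; IAdd 1 1 1; IAdd 1 1 1;
      IStore 1 2; IConst 2 16; IAdd 1 1 2; IStore 1 3; ISub 3 1 2;
      IAdd 1 1 2; IStore 1 4; IAdd 1 1 2; IStore 1 5; IAdd 1 1 2; IStore 1 6;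
      IAdd 1 1 2; IStore 1 7; IAdd 1 1 2; IConst 4 8; IConst 6 1; ISub 5 3 4].

(** Cell 4 is the source, cell 1 the target, cell 2 the stride 16, cell 5 the number of cells left
    and cell 6 the constant 1. Input cells 2 to 7 have been saved before these scratch cells were
    overwritten, so copying resumes at cell 8. *)
Definition prologue_loop :=
  [:: IJz 5 33; ILoad 7 4; IStore 1 7; IAdd 1 1 2; IAdd 4 4 6; ISub 5 5 6; IJmp 26].

Definition prologue_end := [:: IConst 2 0; IAdd 4 0 2; IAdd 5 3 2].

Definition prologue halt :=
  IJz 0 halt :: prologue_init ++ prologue_loop ++ prologue_end.

Ltac rd := repeat match goal with |- context[upd ?M ?a ?x ?b] =>
  first [rewrite (@updE M b x) | rewrite (@updN M a x b); [|lia]] end.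

Lemma effects_add a b c l M x :
  M b + M c = x -> effects (IAdd a b c :: l) M = effects l (upd M a x).
Proof. by move=> <-. Qed.

Lemma effects_sub a b c l M x :
  M b - M c = x -> effects (ISub a b c :: l) M = effects l (upd M a x).
Proof. by move=> <-. Qed.

Lemma effects_const a x l M : effects (IConst a x :: l) M = effects l (upd M a x).
Proof. by []. Qed.

Lemma effects_store a b l (M : memory) x y :
  M a = x -> M b = y -> effects (IStore a b :: l) M = effects l (upd M x y).
Proof. by move=> <- <-. Qed.

Lemma effects_load a b l (M : memory) x y :
  M b = x -> M x = y -> effects (ILoad a b :: l) M = effects l (upd M a y).
Proof. by move=> <- <-. Qed.

Opaque upd.

(** Symbolic execution, one instruction per rewrite. From [0 < n] follows [96 <= S], so the stores
    into the first array hit no scratch cell. *)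
Lemma prologue_initP (M : memory) n m S :
  M 0 = n -> M 1 = m -> 0 < n -> S = 96 * n + 64 * m -> (forall i, S <= i -> M i = 0) ->
  forall A, effects prologue_init M = A ->
  [/\ [/\ A 0 = n, A 1 = S + 16 * 6, A 2 = 16 & A 3 = S],
    [/\ A 4 = 8, A 5 = S - 8 & A 6 = 1],
    forall i, 8 <= i < S -> A i = M i &
    forall i, A (S + 16 * i) = (if i < 6 then M (i + 2) else 0) /\
       forall t, 0 < t < 16 -> A (S + 16 * i + t) = 0].
Proof.
move=> h0 h1 hn hS hz A; rewrite /prologue_init.
rewrite (@effects_add _ _ _ _ _ (n + m)); last by lia.
rewrite (@effects_add _ _ _ _ _ ((n + m) * 2)); last by rd; lia.
rewrite (@effects_add _ _ _ _ _ (3 * n + 2 * m)); last by rd; lia.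
rewrite (@effects_add _ _ _ _ _ (6 * n + 4 * m)); last by rd; lia.
rewrite (@effects_add _ _ _ _ _ (12 * n + 8 * m)); last by rd; lia.
rewrite (@effects_add _ _ _ _ _ (24 * n + 16 * m)); last by rd; lia.
rewrite (@effects_add _ _ _ _ _ (48 * n + 32 * m)); last by rd; lia.
rewrite (@effects_add _ _ _ _ _ S); last by rd; lia.
rewrite (@effects_store _ _ _ _ S (M 2)); [|by rd|by rd].
rewrite effects_const.
rewrite (@effects_add _ _ _ _ _ (S + 16)); last by rd.
rewrite (@effects_store _ _ _ _ (S + 16) (M 3)); [|by rd|by rd].
rewrite (@effects_sub _ _ _ _ _ S); last by rd; lia.
rewrite (@effects_add _ _ _ _ _ (S + 32)); last by rd; lia.
rewrite (@effects_store _ _ _ _ (S + 32) (M 4)); [|by rd|by rd].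
rewrite (@effects_add _ _ _ _ _ (S + 48)); last by rd; lia.
rewrite (@effects_store _ _ _ _ (S + 48) (M 5)); [|by rd|by rd].
rewrite (@effects_add _ _ _ _ _ (S + 64)); last by rd; lia.
rewrite (@effects_store _ _ _ _ (S + 64) (M 6)); [|by rd|by rd].
rewrite (@effects_add _ _ _ _ _ (S + 80)); last by rd; lia.
rewrite (@effects_store _ _ _ _ (S + 80) (M 7)); [|by rd|by rd].
rewrite (@effects_add _ _ _ _ _ (S + 96)); last by rd; lia.
rewrite 2!effects_const (@effects_sub _ _ _ _ _ (S - 8)); last by rd.
move=> <-; rewrite /effects /=; split.
- by split; rd; lia.
- by split; rd; lia.
- by move=> i hi; rd.
- move=> i; split; last first.
    by move=> t ht; rd; apply: hz; lia.
  do 6?[case: i => [|i]]; try by rewrite ?muln0 ?addn0 /=; rd.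
  by rd; apply: hz; lia.
Qed.

Definition copied S n (M A : memory) k :=
  [/\ [/\ A 0 = n, A 1 = S + 16 * (6 + k), A 2 = 16 & A 3 = S],
    [/\ A 4 = 8 + k, A 5 = S - 8 - k & A 6 = 1],
    forall i, 8 <= i < S -> A i = M i &
    forall i, A (S + 16 * i) = (if i < 6 + k then M (i + 2) else 0) /\
       forall t, 0 < t < 16 -> A (S + 16 * i + t) = 0].

Lemma copied_step P S n M A k : code_at P 26 prologue_loop ->
  96 <= S -> 8 + k < S -> copied S n M A k ->
  exists A', steps P 7 26 A = Some (26, A') /\ copied S n M A' k.+1.
Proof.
move=> hc hS hk [[a0 a1 a2 a3] [a4 a5 a6] hi ha].
pose A' := upd (upd (upd (upd (upd A 7 (M (8 + k))) (S + 16 * (6 + k)) (M (8 + k)))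
  1 (S + 16 * (7 + k))) 4 (9 + k)) 5 (S - 8 - k.+1).
exists A'; split.
  case/code_at_cons: hc => i1 /(@code_at_cat _ _ (take 5 (behead prologue_loop)))[c2 /code_at_cons[i3 _]].
  apply: (@steps_seq _ 1 6 _ _ 27 A).
    by rewrite steps1 /step i1 a5 ifF //; lia.
  apply: (@steps_seq _ 5 1 _ _ 32 A'); last by rewrite steps1 /step i3.
  have := steps_straight A (isT : all straight (take 5 (behead prologue_loop))) c2.
  rewrite (_ : effects _ A = A') // /A' [behead _]/= /take.
  rewrite (@effects_load _ _ _ _ (8 + k) (M (8 + k))) //; last by apply: hi; lia.
  rewrite (@effects_store _ _ _ _ (S + 16 * (6 + k)) (M (8 + k))); [|by rd|by rd].
  rewrite (@effects_add _ _ _ _ _ (S + 16 * (7 + k))); last by rd; rewrite a1 a2; lia.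
  rewrite (@effects_add _ _ _ _ _ (9 + k)); last by rd; rewrite a4 a6; lia.
  by rewrite (@effects_sub _ _ _ _ _ (S - 8 - k.+1)) //; rd; rewrite a5 a6; lia.
rewrite /A'; split.
- by split; rd; lia.
- by split; rd; lia.
- by move=> i h; rd; apply: hi.
- move=> i; have [h1 h2] := ha i; split; last first.
    by move=> t ht; rd; exact: h2.
  case: (i =P 6 + k) => [->|ne].
    have e : 6 + k + 2 = 8 + k by lia.
    by rewrite ltn_add2l ltnSn e; rd.
  rd; rewrite h1; congr (if _ then _ else _); lia.
Qed.

(** Input cells below 44 are not erased, so variables other than [vreg 0] and [vreg 1] start with
    leftovers; the represented state therefore reads them off the memory itself. All arrays but the
    first start at zero. *)
Lemma prologueP P halt (M : memory) n m :
  M 0 = n -> M 1 = m -> 0 < n -> (forall i, n + 2 * m + 2 <= i -> M i = 0) ->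
  code_at P 0 (prologue halt) ->
  exists t A, [/\ t <= 700 * (n + m), steps P t 0 M = Some (36, A),
    A 3 = 96 * n + 64 * m &
    represents A (State (fun x => if x < 40 then A (vreg x) else 0)
                 (fun t i => if t == 0 then M (i + 2) else 0)) /\
    A (vreg 0) = n /\ A (vreg 1) = 96 * n + 64 * m].
Proof.
move=> h0 h1 hn hz /code_at_cons[c0 /(@code_at_cat _ _ prologue_init)[c1]].
move=> /(@code_at_cat _ _ prologue_loop)[c2 c3].
set S := 96 * n + 64 * m.
have hS : 96 <= S by rewrite /S; lia.
have hzS i : S <= i -> M i = 0 by move=> hi; apply: hz; move: hi; rewrite /S; lia.
have ci := prologue_initP h0 h1 hn (erefl S) hzS (erefl _).
have := steps_straight M (isT : all straight prologue_init) c1.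
set A0 := effects _ _ in ci *; move=> r1.
have r0 : steps P 26 0 M = Some (26, A0).
  apply: (@steps_seq _ 1 25 _ _ 1 M); last exact: r1.
  by rewrite steps1 /step c0 ifF // h0; lia.
have loop k : 8 + k <= S -> exists A, steps P (26 + 7 * k) 0 M = Some (26, A) /\ copied S n M A k.
  elim: k => [|k IH] hk.
    exists A0; split; first by rewrite muln0 addn0.
    by case: ci => ? [b4 b5 b6] ? ?; split=> //; rewrite b4 b5 b6 subn0.
  have [|A [r iA]] := IH; first by lia.
  have [A' [r' iA']] := @copied_step P S n M A k c2 hS hk iA.
  exists A'; split=> //; rewrite mulnSr addnA; exact: steps_seq r r'.
have [|A1 [r iA]] := loop (S - 8); first by lia.
case: iA => [[a0 a1 a2 a3] [a4 a5 a6] hi ha].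
pose A := upd (upd (upd A1 2 0) 4 n) 5 S.
exists (26 + 7 * (S - 8) + 4), A; split.
- by rewrite /S; lia.
- apply: (steps_seq r).
  case/code_at_cons: c2 => i1 _.
  move: c3; rewrite /prologue_end /= => /code_at_cons[i2 /code_at_cons[i3 /code_at_cons[i4 _]]].
  rewrite /step i1 a5 subnn /= i2 i3 i4.
  by rd; rewrite a0 a3 !addn0.
- by rewrite /A; rd.
split; last by rewrite /A /vreg; split; rd.
split.
- by rewrite /A; rd.
- by rewrite /A; rd; rewrite a3; lia.
- by move=> x hx /=; rewrite hx.
- move=> t i ht /=; have [g1 g2] := ha i.
  rewrite (_ : A 3 = S); last by rewrite /A; rd.
  rewrite /A; rd; case: eqP => [->|nt]; last by rewrite g2 //; lia.
  rewrite addn0 g1; case: ifP => // hik; rewrite hzS //; lia.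
Qed.

(** * Moving the output array to the front of the memory *)

Definition epilogue_init :=
  [:: IConst 5 16; IConst 6 1; IConst 7 11; IConst 8 191; IAdd 8 8 3; IAdd 9 4 6; ISub 9 9 7].

Definition epilogue_loop l :=
  [:: IJz 9 (l + 7); ILoad 10 8; IStore 7 10; IAdd 8 8 5; IAdd 7 7 6; ISub 9 9 6; IJmp l].

(** The copying loop uses cells 5 to 10 as scratch and hence fills only the cells from 11 on. Each
    of the first 11 cells then receives the address of its own entry and is loaded through itself,
    which takes no further scratch. *)
Definition epilogue_end :=
  [:: IConst 0 15; IAdd 0 0 3; IConst 10 16; IAdd 1 0 10; IAdd 2 1 10; IAdd 3 2 10;
      IAdd 4 3 10; IAdd 5 4 10; IAdd 6 5 10; IAdd 7 6 10; IAdd 8 7 10; IAdd 9 8 10;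
      IAdd 10 9 10; ILoad 0 0; ILoad 1 1; ILoad 2 2; ILoad 3 3; ILoad 4 4; ILoad 5 5;
      ILoad 6 6; ILoad 7 7; ILoad 8 8; ILoad 9 9; ILoad 10 10].

Definition epilogue pc := epilogue_init ++ epilogue_loop (pc + 7) ++ epilogue_end ++ [:: IHalt].

Lemma epilogue_endP (M : memory) B f : 11 <= B -> M 3 = B ->
  (forall i, M (B + 16 * i + 15) = f i) ->
  forall A, effects epilogue_end M = A ->
  (forall i, i < 11 -> A i = f i) /\ (forall a, 11 <= a -> A a = M a).
Proof.
move=> hB h3 hf A; rewrite /epilogue_end.
rewrite effects_const (@effects_add _ _ _ _ _ (B + 15)); last by rd; lia.
rewrite effects_const.
do 9![erewrite effects_add; [|by rd; reflexivity]].
rewrite (@effects_add _ _ _ _ _ (B + 175)); last by rd; lia.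
do 11![erewrite effects_load; [|by rd; reflexivity|by rd; reflexivity]].
move=> <-; rewrite /effects /=; split; last by move=> a ha; rd.
do 11![case=> [_|]; first by rd; rewrite -hf; congr M; lia].
by [].
Qed.

Transparent upd.

(** As [n < M 3], the output cells lie below the arrays, so copying never destroys an entry still to
    be read. *)
Lemma epilogueP P pc (M : memory) s n :
  represents M s -> n < M 3 -> reg s 0 = n -> code_at P pc (epilogue pc) ->
  exists t M', [/\ t <= 50 + 7 * n, steps P t pc M = Some (pc + 38, M') &
    forall i, i <= n -> M' i = arr s 15 i].
Proof.
move=> hM hn h0 /(@code_at_cat _ _ epilogue_init)[c1 /(@code_at_cat _ _ (epilogue_loop _))[c2]].
case/(@code_at_cat _ _ epilogue_end)=> c3 _.
case: hM => [m2 m3 mv ma].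
have m4 : M 4 = n by rewrite -h0; apply: (mv 0).
have {}ma i : M (M 3 + 16 * i + 15) = arr s 15 i by exact: ma.
have [B hB] : exists B, M 3 = B by exists (M 3).
rewrite hB in ma m3 hn.
have := steps_straight M (isT : all straight epilogue_init) c1.
rewrite /epilogue_init 4!effects_const.
rewrite (@effects_add _ _ _ _ _ (B + 191)); last by rd; lia.
rewrite (@effects_add _ _ _ _ _ n.+1); last by rd; rewrite m4; lia.
rewrite (@effects_sub _ _ _ _ _ (n.+1 - 11)); last by rd.
set A0 := effects _ _; rewrite [size _]/= => r0.
have loop k : 11 + k <= n.+1 \/ k = 0 -> exists A, steps P (7 + 7 * k) pc M = Some (pc + 7, A) /\
  [/\ [/\ A 3 = B, A 5 = 16, A 6 = 1, A 7 = 11 + k & A 8 = B + 16 * (11 + k) + 15],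
      A 9 = n.+1 - 11 - k, forall i, A (B + 16 * i + 15) = arr s 15 i &
      forall i, 11 <= i < 11 + k -> A i = arr s 15 i].
  elim: k => [|k IH] hk.
    exists A0; split=> //; rewrite /A0 /effects /=; split.
    + by split; rd; lia.
    + by rd; rewrite subn0.
    + by move=> i; rd; apply: ma.
    + by move=> i; lia.
  have [|A [r [[a3 a5 a6 a7 a8] a9 ha hi]]] := IH; first by lia.
  pose A' := upd (upd (upd (upd (upd A 10 (arr s 15 (11 + k))) (11 + k) (arr s 15 (11 + k)))
     8 (B + 16 * (11 + k.+1) + 15)) 7 (11 + k.+1)) 9 (n.+1 - 11 - k.+1).
  exists A'; split.
    rewrite mulnSr addnA; apply: (steps_seq r).
    case/code_at_cons: c2 => i1.
    case/(@code_at_cat _ _ (take 5 (behead (epilogue_loop (pc + 7))))) => c2 /code_at_cons[i3 _].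
    apply: (@steps_seq _ 1 6 _ _ (pc + 7).+1 A).
      by rewrite steps1 /step i1 a9 ifF //; lia.
    apply: (@steps_seq _ 5 1 _ _ ((pc + 7).+1 + 5) A'); last by rewrite steps1 /step i3.
    have := steps_straight A (isT : all straight (take 5 (behead (epilogue_loop (pc + 7))))) c2.
    rewrite (_ : effects _ A = A') // /A' [behead _]/= /take.
    rewrite (@effects_load _ _ _ _ (B + 16 * (11 + k) + 15) (arr s 15 (11 + k))) //.
    rewrite (@effects_store _ _ _ _ (11 + k) (arr s 15 (11 + k))); [|by rd|by rd].
    rewrite (@effects_add _ _ _ _ _ (B + 16 * (11 + k.+1) + 15)); last by rd; rewrite a8 a5; lia.
    rewrite (@effects_add _ _ _ _ _ (11 + k.+1)); last by rd; rewrite a7 a6; lia.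
    by rewrite (@effects_sub _ _ _ _ _ (n.+1 - 11 - k.+1)) //; rd; rewrite a9 a6; lia.
  rewrite /A'; split.
  + by split; rd.
  + by rd.
  + by move=> i; rd; apply: ha.
  + move=> i hik; case: (i =P 11 + k) => [->|ne]; first by rd.
    by rd; apply: hi; lia.
have [|A1 [r [[a3 a5 a6 a7 a8] a9 ha hi]]] := loop (n.+1 - 11); first by lia.
rewrite subnn in a9.
have hB11 : 11 <= B by lia.
have [e1 e2] := @epilogue_endP A1 B (arr s 15) hB11 a3 ha _ (erefl _).
have := steps_straight A1 (isT : all straight epilogue_end) c3.
set A := effects epilogue_end A1 in e1 e2 *; rewrite ![size _]/= => r2.
exists (7 + 7 * (n.+1 - 11) + 25), A; split; first by lia.
  apply: (steps_seq r); apply: (@steps_seq _ 1 24 _ _ (pc + 14) A1); last first.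
    have -> : pc + 14 = pc + 7 + 7 by lia.
    by rewrite r2; congr (Some (_, _)); lia.
  case/code_at_cons: c2 => i1 _.
  by rewrite steps1 /step i1 a9 /=; congr (Some (_, _)); lia.
move=> i hin; case: (ltnP i 11) => h11; first by rewrite e1 //; lia.
by rewrite e2 // hi //; lia.
Qed.

Definition compile c : program :=
  prologue (36 + csize c + 38) ++ ccode 36 0 c ++ epilogue (36 + csize c).

Lemma run_halt (P : program) f pc M : nth IHalt P pc = IHalt -> run P f pc M = Some M.
Proof. by case: f => [|f] /= h; rewrite /step h. Qed.

Lemma compile_code c (P := compile c) :
  [/\ code_at P 0 (prologue (36 + csize c + 38)), code_at P 36 (ccode 36 0 c) &
      code_at P (36 + csize c) (epilogue (36 + csize c))].
Proof.
have : code_at P 0 P by move=> i.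
case/(@code_at_cat _ _ (prologue _)) => c1 /(@code_at_cat _ _ (ccode _ _ _))[c2 c3].
by rewrite size_ccode in c3.
Qed.

Lemma compile_halt c : nth IHalt (compile c) (36 + csize c + 38) = IHalt.
Proof. by have [_ _ ->] := compile_code c. Qed.

(** The case of the empty graph, where the array base would be 0 and fall into the scratch cells. *)
Lemma compile_run0 c f (M : memory) : M 0 = 0 -> run (compile c) f.+1 0 M = Some M.
Proof.
move=> h; have hs : steps (compile c) 1 0 M = Some (36 + csize c + 38, M).
  by rewrite steps1 /step /= h.
by rewrite -add1n (run_steps f hs) run_halt // compile_halt.
Qed.

Lemma compile_run c (M : memory) n m :
  cwf 0 c -> 0 \notin rmod c -> M 0 = n -> M 1 = m -> 0 < n ->
  (forall i, n + 2 * m + 2 <= i -> M i = 0) ->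
  exists s, [/\ reg s 0 = n, reg s 1 = 96 * n + 64 * m,
    arr s = (fun t i => if t == 0 then M (i + 2) else 0) &
    forall f, 1000 * (n + m) + cost c s <= f ->
      exists M', run (compile c) f 0 M = Some M' /\
        forall i, i <= n -> M' i = arr (exec c s) 15 i].
Proof.
move=> wc nc h0 h1 hn hz.
have [c1 c2 c3] := compile_code c.
have [t1 [A [ht1 r1 hB [hr [v0 v1]]]]] := prologueP h0 h1 hn hz c1.
set s := State _ _ in hr; exists s; split=> //.
have [A2 [r2 hr2 b2 _]] := ccode_ok (leq0n 8) wc c2 hr.
have hs0 : reg (exec c s) 0 = n by rewrite (exec_frame c s).1.
have hn2 : n < A2 3 by rewrite b2 hB; lia.
have [t3 [A3 [ht3 r3 out]]] := epilogueP hr2 hn2 hs0 c3.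
have r := steps_seq r1 (steps_seq r2 r3).
move=> f hf; exists A3; split=> //.
have hf' : t1 + (cost c s + t3) <= f by lia.
by rewrite -(subnKC hf') (run_steps _ r) run_halt // compile_halt.
Qed.

(** * Efficient domination and (P2+P4)-free graphs *)

Lemma adjC n (E : edge_list n) a b : adj E a b = adj E b a.
Proof. by rewrite /adj orbC. Qed.

Lemma adj_irr n (E : edge_list n) a : simple_edges E -> adj E a a = false.
Proof.
case/andP=> /allP h _; rewrite /adj orbb; apply/negP => /h /=.
by rewrite eqxx.
Qed.

Lemma domC n (E : edge_list n) a b : dominates E a b = dominates E b a.
Proof. by rewrite /dominates eq_sym adjC. Qed.

Lemma dom_refl n (E : edge_list n) a : dominates E a a.
Proof. by rewrite /dominates eqxx. Qed.

Lemma adj_dom n (E : edge_list n) a b : adj E a b -> dominates E a b.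
Proof. by rewrite /dominates => ->; rewrite orbT. Qed.

Lemma dom_adj n (E : edge_list n) a b : a != b -> dominates E a b -> adj E a b.
Proof. by rewrite /dominates => /negbTE ->. Qed.

(** Listed in the order of the edge list, which is the order in which the algorithm appends to the
    row of [a] in [tNB]. *)
Definition nbrs n (E : edge_list n) (a : 'I_n) : seq 'I_n :=
  flatten [seq (if e.1 == a then [:: e.2] else [::]) ++
               (if e.2 == a then [:: e.1] else [::]) | e <- E].

Definition degree n (E : edge_list n) a := size (nbrs E a).

Lemma nbrs_rcons n (E : edge_list n) e a :
  nbrs (rcons E e) a = nbrs E a ++ (if e.1 == a then [:: e.2] else [::]) ++
               (if e.2 == a then [:: e.1] else [::]).
Proof. by rewrite /nbrs map_rcons flatten_rcons. Qed.

Lemma adj_cons n (E : edge_list n) e a b :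
  adj (e :: E) a b = [|| (e.1 == a) && (e.2 == b), (e.2 == a) && (e.1 == b) | adj E a b].
Proof.
rewrite /adj !inE -!pair_eqE /= !(eq_sym e.1) !(eq_sym e.2).
by rewrite orbACA (andbC (b == _)) -!orbA.
Qed.

Lemma mem_nbrs n (E : edge_list n) a b : (b \in nbrs E a) = adj E a b.
Proof.
elim: E => [|e E IH]; first by rewrite /adj.
rewrite adj_cons -IH /nbrs /= mem_cat -/(nbrs E a) mem_cat -orbA.
by do 2!case: eqP => _; rewrite ?inE ?in_nil /= ?(eq_sym b).
Qed.

Lemma simple_cons n (E : edge_list n) e :
  simple_edges (e :: E) -> [/\ e.1 != e.2, simple_edges E & adj E e.1 e.2 = false].
Proof.
case/andP=> /= /andP[h1 h2] /andP[h3 h4]; split; rewrite ?/simple_edges ?h2 //.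
apply/negP => /orP h; move/negP: h3; apply; apply/mapP.
by case: h => h; eexists; try exact: h; rewrite //= setUC.
Qed.

Lemma uniq_nbrs n (E : edge_list n) a : simple_edges E -> uniq (nbrs E a).
Proof.
elim: E => [|e E IH] // /simple_cons[h1 /IH h2 h3].
rewrite /nbrs /= -/(nbrs E a); case: (altP (e.1 =P a)) => ea; case: (altP (e.2 =P a)) => eb //=.
- by move: h1; rewrite ea eb eqxx.
- by rewrite h2 mem_nbrs -ea h3.
- by rewrite h2 mem_nbrs -eb adjC h3.
Qed.

Lemma simple_catl n (E F : edge_list n) : simple_edges (E ++ F) -> simple_edges E.
Proof.
by rewrite /simple_edges all_cat map_cat cat_uniq => /andP[/andP[-> _] /and3P[-> _ _]].
Qed.

Lemma card_dom n (E : edge_list n) a : simple_edges E ->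
  #|[set y | dominates E a y]| = (degree E a).+1.
Proof.
move=> hs; rewrite /degree -(card_uniqP (uniq_nbrs a hs)).
rewrite (_ : [set y | _] = a |: [set y in nbrs E a]); last first.
  by apply/setP=> y; rewrite !inE mem_nbrs /dominates eq_sym.
by rewrite cardsU1 inE mem_nbrs adj_irr // add1n cardsE.
Qed.

Lemma degree_lt n (E : edge_list n) a : simple_edges E -> degree E a < n.
Proof. by move=> hs; rewrite -card_dom // -[X in _ <= X]card_ord max_card. Qed.

Lemma sum_degree n (E : edge_list n) : \sum_a degree E a = 2 * size E.
Proof.
elim: E => [|e E IH].
  by rewrite muln0 big1.
have h (b : 'I_n) : \sum_a (b == a : nat) = 1.
  by rewrite (bigD1 b) //= eqxx big1 // => a /negbTE; rewrite eq_sym => ->.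
have -> : \sum_a degree (e :: E) a = \sum_a ((e.1 == a) + (e.2 == a) + degree E a).
  apply: eq_bigr => a _; rewrite /degree /nbrs /= !size_cat -!/(nbrs E a).
  by do 2!case: eqP.
by rewrite !big_split /= !h IH; lia.
Qed.

Lemma ed_ex n (E : edge_list n) (D : {set 'I_n}) y : efficient_dom E D -> exists2 d, d \in D & dominates E d y.
Proof.
move/(_ y) => /eqP/cards1P[d hd]; have : d \in [set d in D | dominates E d y] by rewrite hd set11.
by rewrite inE => /andP[]; exists d.
Qed.

Lemma ed_uniq n (E : edge_list n) (D : {set 'I_n}) y d d' : efficient_dom E D -> d \in D -> d' \in D ->
  dominates E d y -> dominates E d' y -> d = d'.
Proof.
move/(_ y) => /eqP/cards1P[c hc] h1 h2 h3 h4.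
have : d \in [set d in D | dominates E d y] by rewrite inE h1.
have : d' \in [set d in D | dominates E d y] by rewrite inE h2.
by rewrite hc !inE => /eqP-> /eqP->.
Qed.

Lemma ed_intro n (E : edge_list n) (D : {set 'I_n}) :
  (forall y, exists2 d, d \in D & dominates E d y) ->
  (forall y d d', d \in D -> d' \in D -> dominates E d y -> dominates E d' y -> d = d') ->
  efficient_dom E D.
Proof.
move=> h1 h2 y; have [d hd hdy] := h1 y; apply/eqP/cards1P; exists d.
apply/setP=> c; rewrite !inE; apply/andP/eqP => [[hc hcy]|->//].
exact: h2 hcy hdy.
Qed.

(** Double counting of the pairs of a member of [D] and a vertex dominated by it: every vertex
    occurs in exactly one. *)
Lemma ed_sum n (E : edge_list n) (D : {set 'I_n}) : simple_edges E -> efficient_dom E D ->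
  \sum_(d in D) (degree E d).+1 = n.
Proof.
move=> hs hD.
have -> : \sum_(d in D) (degree E d).+1 = \sum_(d in D) \sum_y (dominates E d y : nat).
  apply: eq_bigr => d _; rewrite -card_dom // -sum1_card [RHS]big_mkcond /= [LHS]big_mkcond.
  by apply: eq_bigr => y _; rewrite inE; case: ifP; case: (dominates _ _ _).
rewrite exchange_big /= -[RHS]card_ord -sum1_card; apply: eq_bigr => y _.
rewrite -(hD y) -sum1_card [RHS]big_mkcond [LHS]big_mkcond; apply: eq_bigr => d _.
by rewrite inE; case: (d \in D) => //=; case: ifP.
Qed.

(** * Efficient dominating sets containing both ends of an induced P4 *)

Definition p4 n (E : edge_list n) v u x d :=
  [&& adj E v u, adj E u x, adj E x d, ~~ dominates E v x, ~~ dominates E v d & ~~ dominates E u d].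

Definition far n (E : edge_list n) v u x d :=
  [set y | ~~ [|| dominates E v y, dominates E u y, dominates E x y | dominates E d y]].

Lemma far_edge n (E : edge_list n) v u x d a b : simple_edges E -> p4 E v u x d ->
  a \in far E v u x d -> b \in far E v u x d -> adj E a b -> has_induced_P2P4 E.
Proof.
move=> hs /and4P[vu ux xd]; rewrite /dominates !negb_or.
case/and3P=> /andP[n1 n2] /andP[n3 n4] /andP[n5 n6].
rewrite /far !inE /dominates !negb_or.
case/and4P=> /andP[a1 a2] /andP[a3 a4] /andP[a5 a6] /andP[a7 a8].
case/and4P=> /andP[b1 b2] /andP[b3 b4] /andP[b5 b6] /andP[b7 b8] ab.
have irr c e : adj E c e -> c != e.
  by apply: contraTneq => ->; rewrite adj_irr.
(* The numbering of [p2p4_adj]: 0 and 1 form the P2, 2 to 5 the P4 in path order. *)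
pose f (i : 'I_6) := nth a [:: a; b; v; u; x; d] i.
exists f; split; last first.
  have T c e : adj E c e -> (adj E c e = true) * (adj E e c = true).
    by move=> h; rewrite (adjC E e).
  have F c e : ((c, e) \notin E) && ((e, c) \notin E) -> (adj E c e = false) * (adj E e c = false).
    by rewrite -negb_or => /negbTE h; rewrite (adjC E e).
  have facts := (T _ _ ab, T _ _ vu, T _ _ ux, T _ _ xd, F _ _ n2, F _ _ n4, F _ _ n6,
    (F _ _ a2, F _ _ a4, F _ _ a6, F _ _ a8), (F _ _ b2, F _ _ b4, F _ _ b6, F _ _ b8)).
  move=> [i hi] [j hj]; rewrite /f /=.
  by do 6?[case: i hi => [|i] hi //]; do 6?[case: j hj => [|j] hj //];
     rewrite /p2p4_adj /minn /maxn /= ?adj_irr ?facts.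
have hu : uniq [:: a; b; v; u; x; d].
  rewrite /= !inE !negb_or (irr _ _ ab) (irr _ _ vu) (irr _ _ ux) (irr _ _ xd) n1 n3 n5.
  by rewrite !(eq_sym a) !(eq_sym b) a1 a3 a5 a7 b1 b3 b5 b7.
by move=> i j /eqP; rewrite /f nth_uniq // => /eqP /val_inj.
Qed.

Lemma ed_sub_far n (E : edge_list n) (D : {set 'I_n}) v u x d : p4 E v u x d -> efficient_dom E D ->
  v \in D -> d \in D -> D \subset v |: (d |: far E v u x d).
Proof.
move=> /and4P[vu ux xd _] hD hv hd; apply/subsetP => y hy; rewrite !in_setU1.
have dv : dominates E d x by rewrite domC adj_dom.
case: eqP => //= nv; case: eqP => //= nd; rewrite /far inE.
apply/negP => /or4P[] h.
- exact: (nv (ed_uniq hD hy hv (dom_refl E y) h)).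
- by apply: nv; apply: (ed_uniq hD hy hv (y := u)); [rewrite domC | apply: adj_dom].
- by apply: nd; apply: (ed_uniq hD hy hd (y := x)); [rewrite domC | ].
- exact: (nd (ed_uniq hD hy hd (dom_refl E y) h)).
Qed.

(** The member of [D] dominating [z] is [v], [d] or a far vertex; the first two dominate no far
    vertex and [z] has no far neighbour, so it is [z] itself. *)
Lemma isolated_in_ed n (E : edge_list n) (D : {set 'I_n}) v u x d z : p4 E v u x d -> efficient_dom E D ->
  v \in D -> d \in D -> z \in v |: (d |: far E v u x d) ->
  (forall y, y \in far E v u x d -> ~~ adj E z y) -> z \in D.
Proof.
move=> hp hD hv hd; rewrite !in_setU1 => /or3P[/eqP->|/eqP->|hz] // hi.
have [c hc hcz] := ed_ex z hD.
case: (altP (c =P z)) => [<-//|ncz].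
have := subsetP (ed_sub_far hp hD hv hd) c hc; rewrite !in_setU1 => /or3P[/eqP ec|/eqP ec|hc2].
- by move: hz; rewrite /far inE -ec hcz.
- by move: hz; rewrite /far inE -ec hcz !orbT.
- by have := hi _ hc2; rewrite adjC dom_adj.
Qed.

(** * Full vertices and the components that contain one *)

Definition full n (E : edge_list n) v := all (fun e => dominates E v e.1 == dominates E v e.2) E.

Lemma full_closed n (E : edge_list n) v a b : full E v -> dominates E v a -> adj E a b -> dominates E v b.
Proof.
move=> /allP h ha /orP[] /h /= /eqP e; by [rewrite -e | rewrite e].
Qed.

Lemma fullPn n (E : edge_list n) v : ~~ full E v ->
  exists a b, [/\ adj E a b, dominates E v a & ~~ dominates E v b].
Proof.
case/allPn=> -[a b] he /=; case ha: (dominates E v a); case hb: (dominates E v b) => // _.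
- by exists a, b; rewrite ha hb /adj he.
- by exists b, a; rewrite ha hb /adj he orbT.
Qed.

(** Components are never formalised: the component of a full vertex [q] is its closed neighbourhood,
    so this says that the component of [y] has a full vertex. *)
Definition good n (E : edge_list n) y := [exists q, full E q && dominates E q y].

Lemma good_closed n (E : edge_list n) a b : adj E a b -> good E b = good E a.
Proof.
move=> h; apply/existsP/existsP => -[q /andP[fq hq]]; exists q; rewrite fq /=.
- by apply: (full_closed fq hq); rewrite adjC.
- exact: (full_closed fq hq).
Qed.

Lemma full_adj n (E : edge_list n) p q y : full E p -> full E q ->
  dominates E p y -> dominates E q y -> dominates E p q.
Proof.
move=> hp hq py qy; case: (altP (q =P y)) => [->//|ne].
by apply: (full_closed hp py); rewrite adjC dom_adj.
Qed.

Lemma full_subset n (E : edge_list n) p q y : full E p -> dominates E p q -> dominates E q y ->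
  dominates E p y.
Proof.
move=> hp pq; case: (altP (q =P y)) => [<-//|ne] /(dom_adj ne); exact: full_closed hp pq.
Qed.

(** The last two hypotheses describe, without components, a choice of one lightest full vertex in
    each. Optimality comes from an injection of [D] into any e.d. that never decreases weights. *)
Lemma full_ed_optimal n (E : edge_list n) (w : 'I_n -> nat) (D : {set 'I_n}) :
  (forall y, good E y) -> (forall q, q \in D -> full E q) ->
  (forall p q, p \in D -> q \in D -> ~~ adj E p q) ->
  (forall v, full E v -> exists q, [/\ q \in D, dominates E q v & w q <= w v]) ->
  efficient_dom E D /\ forall D', efficient_dom E D' -> weight w D <= weight w D'.
Proof.
move=> hg hf hn hw.
have uq y p q : p \in D -> q \in D -> dominates E p y -> dominates E q y -> p = q.
  move=> hp hq py qy; apply/eqP; apply: contraTT (full_adj (hf _ hp) (hf _ hq) py qy) => ne.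
  by rewrite /dominates (negbTE ne) /=; apply: hn.
split.
  apply: ed_intro; last by move=> y p q; apply: uq.
  move=> y; have /existsP[v /andP[fv vy]] := hg y.
  have [q [hq qv _]] := hw v fv; exists q => //; exact: full_subset (hf _ hq) qv vy.
move=> D' hD'.
(* [g q] is the vertex of [D'] dominating [q]; the point is that it is full too, so that the
   lightness of [q] applies to it. *)
have /fin_all_exists[g hgD] (q : 'I_n) : exists d, q \in D -> [/\ d \in D', dominates E q d & w q <= w d].
  case: (boolP (q \in D)) => hq; last by exists q.
  have [d hd dq] := ed_ex q hD'; exists d => _.
  have qd : dominates E q d by rewrite domC.
  have fd : full E d.
    (* The dominator of [y] in [D'] lies in the same component, hence also dominates [q], and
       uniqueness makes it [d]. *)
    have cell y : dominates E q y -> dominates E d y.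
      move=> qy; have [c hc cy] := ed_ex y hD'.
      have qc : dominates E q c by apply: (full_subset (hf _ hq) qy); rewrite domC.
      by rewrite (ed_uniq hD' hd hc dq) // domC.
    apply/allP => e he; have a12 : adj E e.1 e.2 by rewrite /adj -surjective_pairing he.
    apply/eqP; apply/idP/idP => h; apply: cell.
    - exact: (full_closed (hf _ hq) (full_subset (hf _ hq) qd h) a12).
    - by apply: (full_closed (hf _ hq) (full_subset (hf _ hq) qd h)); rewrite adjC.
  split=> //; have [p [hp pd wp]] := hw d fd.
  by rewrite (uq d q p).
apply: (@leq_trans (\sum_(q in D) w (g q))).
  by apply: leq_sum => q /hgD[].
have gi : {in D &, injective g}.
  move=> p q hp hq e; have [_ h1 _] := hgD _ hp; have [_ h2 _] := hgD _ hq.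
  by apply: (uq (g p)) => //; rewrite e.
rewrite -(big_imset _ gi) /= /weight.
apply: sub_le_big => //=; first by move=> a b; apply: leq_addr.
by move=> d /imsetP[q hq ->]; have [] := hgD _ hq.
Qed.

(** * Distance levels around a vertex, and the number of pairs *)

Definition level2 n (E : edge_list n) v x := ~~ dominates E v x && [exists u, adj E v u && adj E u x].

Lemma level2I n (E : edge_list n) v u x :
  dominates E v u -> ~~ dominates E v x -> adj E u x -> adj E v u /\ level2 E v x.
Proof.
move=> vu vx ux; have a : adj E v u.
  by apply: dom_adj => //; apply: contraNneq vx => ->; apply: adj_dom.
by split=> //; rewrite /level2 vx; apply/existsP; exists u; rewrite a.
Qed.

(** Take an edge u-x leaving N[v] and the [d] in [D] dominating [x]. At distance less than 3 from
    [v], or equal to [x], it would share a dominated vertex with [v]. *)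
Lemma ed_level3 n (E : edge_list n) (D : {set 'I_n}) v : efficient_dom E D -> v \in D -> ~~ full E v ->
  exists x d, [/\ d \in D, level2 E v x, adj E x d, ~~ dominates E v d & ~~ level2 E v d].
Proof.
move=> hD hv /fullPn[u [x [ux vu vx]]].
have [vu' l2] := level2I vu vx ux.
have [d hd dx] := ed_ex x hD.
exists x, d; split=> //.
- apply: dom_adj; last by rewrite domC.
  apply/eqP => e; move/negP: vx; apply; rewrite e.
  have du : dominates E d u by rewrite -e domC adj_dom.
  by rewrite (ed_uniq hD hv hd vu du) dom_refl.
- apply/negP => vd; move/negP: vx; apply.
  by rewrite (ed_uniq hD hv hd vd) ?dom_refl.
- apply/negP => /andP[_ /existsP[t /andP[vt td]]]; move/negP: vx; apply.
  by rewrite (ed_uniq hD hv hd (adj_dom vt)) // domC adj_dom.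
Qed.

Lemma p4I n (E : edge_list n) v u x d :
  dominates E v u -> adj E u x -> adj E x d -> ~~ dominates E v x -> ~~ dominates E v d ->
  ~~ level2 E v d -> p4 E v u x d.
Proof.
move=> vu ux xd vx vd nl; have [vu' _] := level2I vu vx ux.
apply/and4P; split=> //; rewrite vx vd /=.
apply/negP => ud; move/negP: nl; apply.
by have [] := level2I vu vd (dom_adj _ ud); first by apply: contraNneq vd => <-.
Qed.

(** By minimality [degree E w] times the number of non-good vertices is at most the degree sum, 2 m.
    A non-full vertex has a neighbour, so [(degree E w).+1] is at most twice the degree, whence the
    4. *)
Lemma min_degree_bound n (E : edge_list n) w : simple_edges E -> ~~ good E w ->
  (forall y, ~~ good E y -> degree E w <= degree E y) ->
  (degree E w).+1 * #|[set y | ~~ good E y]| <= 4 * size E.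
Proof.
move=> hs hw hmin; set W := [set y | _].
have h : degree E w * #|W| <= 2 * size E.
  rewrite -sum_degree mulnC -sum_nat_const.
  apply: (@leq_trans (\sum_(y in W) degree E y)).
    by apply: leq_sum => y; rewrite inE; apply: hmin.
  by apply: sub_le_big => //= a b; apply: leq_addr.
have : 0 < degree E w.
  have nf : ~~ full E w.
    by apply: contra hw => fw; apply/existsP; exists w; rewrite fw dom_refl.
  have [u [x [ux wu wx]]] := fullPn nf; have [wu' _] := level2I wu wx ux.
  by rewrite /degree; move: wu'; rewrite -mem_nbrs; case: (nbrs E w).
by nia.
Qed.

(** * The algorithm *)

Coercion EVar : nat >-> expr.
Notation "a [+] b" := (EAdd a b) (at level 50, left associativity).
Notation "a [-] b" := (ESub a b) (at level 50, left associativity).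
Notation "t '@[' e ]" := (EArr t e) (at level 8, e at level 60).
Notation "'#' k" := (EConst k) (at level 8).
Notation "x <~ e" := (CSet x e) (at level 61).
Notation "t '@@[' i ] <~ e" := (CPut t i e) (at level 61, i at level 60, e at level 60).
Notation "c1 ;; c2" := (CSeq c1 c2) (at level 62, right associativity).

Notation vN := 0. Notation vS := 1. Notation vM := 2. Notation vJ := 3.
Notation vA := 4. Notation vB := 5. Notation vV := 6. Notation vF := 7.
Notation vR := 8. Notation vT := 9. Notation vX := 10. Notation vW := 11.
Notation vMin := 12. Notation vY := 13. Notation vK := 14. Notation vD := 15.
Notation vU := 16. Notation vSum := 17. Notation vTwo := 18. Notation vOk := 19.
Notation vWt := 20. Notation vHas := 21. Notation vBW := 22. Notation vNull := 23.

Notation tIN := 0. Notation tROW := 1. Notation tCL := 2. Notation tDEG := 3.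
Notation tNB := 4. Notation tFULL := 5. Notation tGOOD := 6. Notation tP2 := 7.
Notation tP3 := 8. Notation tZ := 9. Notation tDD := 10. Notation tCOV := 11.
Notation tBEST := 12. Notation tOUT := 15.

(* [tCL] is the matrix of [dominates], row by row, [tROW] the table of the row
   offsets [a * n], and [tNB] holds the neighbours of [a] from [a * n] on.
   For the current [v], [tP2] stores [u.+1] at [x] when v-u-x is an induced
   path, and [tP3] stores [x.+1] at [d] when x-d continues it to an induced
   P4.  [tOUT] holds the answer code followed by the output set. *)
Definition skip := vNull <~ #0.
Definition when e c := CIf e c skip.
(** The array [tIN] omits the two header cells of the input, so edge [j] starts at index n + 2 j. *)
Definition for_edge c :=
  CFor vJ vM (vA <~ tIN@[vN [+] (vJ [+] vJ)];; vB <~ tIN@[vN [+] (vJ [+] vJ) [+] #1];; c).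
Definition closed_nb (a b : expr) := tCL@[tROW@[a] [+] b].

(** The input cell with m was overwritten while the base was computed. Subtracting 96 n from the
    base leaves 64 m, and the indices [j] with 64 j < 64 m are counted, for want of a division. *)
Definition p_count :=
  (vM <~ #0;; vT <~ vN [+] vN [+] vN;; vT <~ vT [+] vT;; vT <~ vT [+] vT;;
   vT <~ vT [+] vT;; vT <~ vT [+] vT;; vT <~ vT [+] vT;; vX <~ vS [-] vT);;
  CFor vJ vX (vT <~ vJ [+] vJ;; vT <~ vT [+] vT;; vT <~ vT [+] vT;; vT <~ vT [+] vT;;
   vT <~ vT [+] vT;; vT <~ vT [+] vT;; when (vX [-] vT) (vM <~ vM [+] #1)).

(** Only the diagonal of the matrix is written, in time O(n); the remaining entries are already
    zero. *)
Definition p_row :=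
  vR <~ #0;;
  CFor vA vN (tROW@@[vA] <~ vR;; tCL@@[vR [+] vA] <~ #1;; vR <~ vR [+] vN).

Definition p_edges :=
  for_edge
   (tCL@@[tROW@[vA] [+] vB] <~ #1;; tCL@@[tROW@[vB] [+] vA] <~ #1;;
    tNB@@[tROW@[vA] [+] tDEG@[vA]] <~ vB;; tDEG@@[vA] <~ tDEG@[vA] [+] #1;;
    tNB@@[tROW@[vB] [+] tDEG@[vB]] <~ vA;; tDEG@@[vB] <~ tDEG@[vB] [+] #1).

(** The two truncated differences add up to zero exactly when the entries agree. *)
Definition p_full_body :=
  when ((closed_nb vV vA [-] closed_nb vV vB) [+] (closed_nb vV vB [-] closed_nb vV vA)) (vF <~ #0).

Definition p_full :=
  CFor vV vN (vF <~ #1;; for_edge p_full_body;; tFULL@@[vV] <~ vF;; tGOOD@@[vV] <~ vF).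

(** [tGOOD] starts as [tFULL], so in the end it counts the full vertices of the closed
    neighbourhood. *)
Definition p_good :=
  for_edge (tGOOD@@[vA] <~ tGOOD@[vA] [+] tFULL@[vB];; tGOOD@@[vB] <~ tGOOD@[vB] [+] tFULL@[vA]).

(* Minimality of [deg w] among the non-good vertices bounds the number of pairs
   (v, d) tested in [p_search] by [4 m]. *)
Definition p_min :=
  vMin <~ vN;;
  CFor vV vN (CIf tGOOD@[vV] skip
    (when (vMin [-] tDEG@[vV]) (vW <~ vV;; vMin <~ tDEG@[vV]))).

(** Full vertices of one component are pairwise adjacent. Deleting the heavier end of each edge
    whose ends both survive therefore leaves a single lightest one per component, after one pass
    over the edges. *)
Definition p_universal :=
  CFor vV vN (tOUT@@[vV [+] #1] <~ tFULL@[vV]);;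
  for_edge (when tOUT@[vA [+] #1] (when tOUT@[vB [+] #1]
    (CIf (tIN@[vA] [-] tIN@[vB]) (tOUT@@[vA [+] #1] <~ #0) (tOUT@@[vB [+] #1] <~ #0)))).

(** The second pass over the edges reads [tP2] as the test for distance 2, so it can start only
    after the first is complete. *)
Definition p_levels :=
  CFor vY vN (tP2@@[vY] <~ #0;; tP3@@[vY] <~ #0);;
  for_edge (CIf (closed_nb vV vA) (CIf (closed_nb vV vB) skip (tP2@@[vB] <~ vA [+] #1))
                                  (when (closed_nb vV vB) (tP2@@[vA] <~ vB [+] #1)));;
  for_edge (when tP2@[vA] (when (#1 [-] (closed_nb vV vB [+] tP2@[vB])) (tP3@@[vB] <~ vA [+] #1));;
            when tP2@[vB] (when (#1 [-] (closed_nb vV vA [+] tP2@[vA])) (tP3@@[vA] <~ vB [+] #1))).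

Definition p_init_test :=
  CFor vY vN
    (tZ@@[vY] <~ #1 [-] (closed_nb vV vY [+] closed_nb vU vY [+] closed_nb vX vY [+] closed_nb vD vY);;
     tDD@@[vY] <~ tZ@[vY];; tCOV@@[vY] <~ #0).

Definition scan := CFor vK tDEG@[vY]
       (vB <~ tNB@[tROW@[vY] [+] vK];; tCOV@@[vB] <~ tCOV@[vB] [+] #1;;
        when tZ@[vB] (vTwo <~ #1)).

Definition visit :=
  (vSum <~ vSum [+] tDEG@[vY] [+] #1;; tCOV@@[vY] <~ tCOV@[vY] [+] #1);; scan.

(* Once [vSum] exceeds [n] no further vertex is visited, so that this loop is
   linear in [n]; the candidate is then rejected, because the closed
   neighbourhoods of an e.d. have total size exactly [n]. *)
Definition p_cover := CFor vY vN (when tDD@[vY] (when (vN [+] #1 [-] vSum) visit)).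

Definition p_check :=
  CFor vY vN (when ((tCOV@[vY] [-] #1) [+] (#1 [-] tCOV@[vY])) (vOk <~ #0);;
              when tDD@[vY] (vWt <~ vWt [+] tIN@[vY])).

(** [vHas] is kept apart from [vBW] because a candidate may have weight 0. *)
Definition p_record :=
  when vOk (CIf vHas (vF <~ vBW [-] vWt) (vF <~ #1);;
    when vF ((vHas <~ #1;; vBW <~ vWt);; CFor vY vN (tBEST@@[vY] <~ tDD@[vY]))).

(** [vOk] starts nonzero exactly when [vSum] is at most n; then every vertex of the candidate was
    visited and [tCOV] holds its true domination counts. *)
Definition p_test :=
  p_init_test;; (tDD@@[vV] <~ #1;; tDD@@[vD] <~ #1;; vSum <~ #0);; p_cover;;
  (vOk <~ vN [+] #1 [-] vSum;; vWt <~ #0);; p_check;; p_record.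

Definition p_search :=
  CFor vD vN (when tP3@[vD] ((vX <~ tP3@[vD] [-] #1;; vU <~ tP2@[vX] [-] #1);; p_test)).

(** [vTwo] takes precedence over the recorded set: once it is raised, optimality of that set is no
    longer guaranteed, but the answer 2 is justified. *)
Definition p_nonuniversal :=
  (vTwo <~ #0;; vHas <~ #0;; vBW <~ #0);;
  CFor vV vN (when (closed_nb vW vV) (p_levels;; p_search));;
  CIf vTwo (tOUT@@[#0] <~ #2)
    (CIf vHas (CFor vY vN (tOUT@@[vY [+] #1] <~ tBEST@[vY])) (tOUT@@[#0] <~ #1)).

Definition wed_program :=
  p_count;; p_row;; p_edges;; p_full;; p_good;; p_min;;
  CIf (vN [-] vMin) p_nonuniversal p_universal.

Lemma wed_program_wf : cwf 0 wed_program.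
Proof. by vm_compute. Qed.

(** * Correctness and running time *)

Lemma exec_seq c1 c2 s : exec (c1;; c2) s = exec c2 (exec c1 s).
Proof. by []. Qed.

Lemma cost_seq c1 c2 s : cost (c1;; c2) s = cost c1 s + cost c2 (exec c1 s).
Proof. by []. Qed.

Lemma eval_var s x : eval s (EVar x) = reg s x.
Proof. by []. Qed.

Lemma exec_when e c s : exec (when e c) s =
  if eval s e == 0 then setr vNull 0 s else exec c s.
Proof. by []. Qed.

Lemma p_count_ok s n m : reg s vN = n -> reg s vS = 96 * n + 64 * m ->
  reg (exec p_count s) vM = m /\ cost p_count s <= 100 * max_cost p_count * m.+1.
Proof.
move=> hn hS; rewrite /p_count exec_seq cost_seq.
set c1 := (vM <~ #0;; _); set c := (vT <~ vJ [+] vJ;; _).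
set s1 := exec c1 s.
have [hM hX] : reg s1 vM = 0 /\ reg s1 vX = 64 * m.
  by rewrite /s1 /= /upd /= hn hS; split=> //; lia.
(* The loop makes 64 m iterations, but the counter stops growing once [k] reaches [m]. *)
have := @for_loop_free vJ vX c s1 (fun k s => reg s vM = minn k m) isT.
case; first by rewrite hM min0n.
- move=> k s' /= hk [fr _] ih; rewrite /upd /= fr // hX ih.
  by case: eqP => /=; rewrite /upd /= ?ih; lia.
rewrite eval_var hX => -> h; split; first by lia.
have := @cost_loop_free c1 s isT; move: h.
rewrite (_ : max_cost (c1;; _) = max_cost c1 + max_cost (CFor vJ vX c)) //.
move: (max_cost c1) (max_cost _) => K1 K2; nia.
Qed.

Section Input.
Variables (n : nat) (E : edge_list n) (w : 'I_n -> nat).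

(** Edges are located through splittings of [E], the form in which loops over the edges meet
    them. *)
Definition has_input s :=
  [/\ reg s vN = n, reg s vM = size E, forall v : 'I_n, arr s tIN v = w v &
    forall p e r, E = p ++ e :: r ->
      arr s tIN (n + (size p + size p)) = e.1 /\ arr s tIN (n + (size p + size p) + 1) = e.2].

Lemma has_input_frame c s s' : frame c s s' ->
  [&& vN \notin rmod c, vM \notin rmod c & tIN \notin amod c] -> has_input s -> has_input s'.
Proof. by case=> fr fa /and3P[h1 h2 h3]; rewrite /has_input !fr ?fa. Qed.

(** The invariant is indexed by the list of processed edges, so it can speak of the subgraph seen so
    far. *)
Lemma for_edgeP c s (J : edge_list n -> state -> Prop) :
  has_input s -> [&& vN \notin rmod c, vM \notin rmod c & tIN \notin amod c] ->
  loop_free c -> J [::] s ->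
  (forall p e r s', E = p ++ e :: r -> frame (for_edge c) s s' -> J p s' ->
     J (rcons p e) (exec c (setr vB e.2 (setr vA e.1 (setr vJ (size p) s'))))) ->
  J E (exec (for_edge c) s) /\ cost (for_edge c) s <= max_cost (for_edge c) * (size E).+1.
Proof.
move=> hin hc lf J0 Jk; case: (hin) => [hn hm hw he].
pose body := (vA <~ tIN@[vN [+] (vJ [+] vJ)];; vB <~ tIN@[vN [+] (vJ [+] vJ) [+] #1];; c).
have := @for_loop_free vJ vM body s (fun k s => J (take k E) s) lf.
case; first by rewrite take0.
- move=> k s' /=; rewrite hm => hk fr ih.
  (* A default value for [nth], taken from the nonempty [E] because ['I_n] could be empty. *)
  have [e0 _] : exists e0 : 'I_n * 'I_n, True by case: (E) hk => // e *; exists e.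
  pose e := nth e0 E k.
  have hE : E = take k E ++ e :: drop k.+1 E by rewrite -drop_nth // cat_take_drop.
  have hin' : has_input s'.
    by apply: (has_input_frame fr) hin; case/and3P: hc => h1 h2 h3; rewrite /= !inE h1 h2 h3.
  case: (hin') => hn' _ _ /(_ _ _ _ hE).
  have sk : size (take k E) = k by rewrite size_takel // ltnW.
  rewrite sk => -[e1 e2].
  have := Jk _ _ _ s' hE fr ih; rewrite sk -take_nth //.
  congr J; congr exec; rewrite /setr /= /upd /= hn' e1.
  by rewrite e2.
- by rewrite eval_var hm take_size.
Qed.

End Input.

(** Uniqueness of Euclidean division: distinct matrix positions occupy distinct cells. *)
Lemma index_eq n a b a' b' : b < n -> b' < n ->
  (a * n + b == a' * n + b') = (a == a') && (b == b').
Proof.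
move=> hb hb'; apply/eqP/andP => [e|[/eqP-> /eqP->]//].
by move: (f_equal (edivn^~ n) e); rewrite !edivn_eq // => -[-> ->].
Qed.

Section Graph.
Variables (n : nat) (E : edge_list n) (w : 'I_n -> nat).
Hypothesis simpleE : simple_edges E.

Definition has_graph s :=
  has_input E w s /\
  [/\ forall a : 'I_n, arr s tROW a = a * n,
      forall a b : 'I_n, arr s tCL (a * n + b) = dominates E a b,
      forall a : 'I_n, arr s tDEG a = degree E a &
      forall (a : 'I_n) k, k < degree E a ->
        arr s tNB (a * n + k) = nth 0 [seq val b | b <- nbrs E a] k].

Lemma has_graph_frame c s s' : frame c s s' ->
  [&& vN \notin rmod c, vM \notin rmod c & all (fun t => t \notin amod c) [:: tIN; tROW; tCL; tDEG; tNB]] ->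
  has_graph s -> has_graph s'.
Proof.
move=> fr /= /and5P[h1 h2 h3 h4 /and4P[h5 h6 h7 _]] [hin hg]; split.
  by apply: (has_input_frame fr) hin; rewrite h1 h2 h3.
by case: fr => _ fa; rewrite !fa.
Qed.

Lemma p_row_ok s : has_input E w s -> (forall i, arr s tCL i = 0) ->
  [/\ forall a : 'I_n, arr (exec p_row s) tROW a = a * n,
      forall a b : 'I_n, arr (exec p_row s) tCL (a * n + b) = (a == b) &
      cost p_row s <= max_cost p_row * n.+1].
Proof.
move=> hin hz; rewrite /p_row exec_seq cost_seq; set c1 := (vR <~ #0); set s1 := exec c1 s.
set c := (tROW@@[vA] <~ _;; _).
have hn : reg s1 vN = n by case: hin.
have := @for_loop_free vA vN c s1 (fun k s => [/\ reg s vR = k * n,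
  forall a : 'I_n, a < k -> arr s tROW a = a * n &
  forall a b : 'I_n, arr s tCL (a * n + b) = (a < k) && (a == b)]) isT.
case.
- by split; [rewrite mul0n | | move=> a b; rewrite [arr _ _]/= hz].
- move=> k s'; rewrite eval_var hn => hk [fr _] [hR hrow hcl]; split.
  + by rewrite /= /upd /= hR fr // hn mulSn addnC.
  + move=> a; rewrite /= /upd /= ltnS (leq_eqVlt a) hR; case: eqP => [->//|_] /=; exact: hrow.
  + move=> a b; rewrite /= /upd /= hR hcl ltnS (leq_eqVlt a) index_eq //.
    case: (altP (a =P b)) => [->|nab]; first by rewrite andbb !andbT; case: eqP.
    rewrite !andbF; case: eqP => //= ea; case: eqP => // eb.
    by move/eqP: nab; case; apply: val_inj; rewrite /= ea eb.
rewrite eval_var hn => -[_ hrow hcl] hc; split.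
- by move=> a; apply: hrow.
- by move=> a b; rewrite hcl ltn_ord.
- rewrite (_ : max_cost (c1;; _) = max_cost c1 + max_cost (CFor vA vN c)) //.
  have := @cost_loop_free c1 s isT.
  move: (max_cost c1) (max_cost _) hc => K1 K2; nia.
Qed.

Lemma dominates_rcons p e (a b : 'I_n) : dominates (rcons p e) a b =
  [|| dominates p a b, (e.1 == a) && (e.2 == b) | (e.2 == a) && (e.1 == b)].
Proof.
rewrite /dominates -!mem_nbrs nbrs_rcons !mem_cat -orbA; congr [|| _, _ | _].
by do 2!case: eqP => _; rewrite ?inE ?in_nil //= !(eq_sym b).
Qed.

Lemma p_edges_ok s : has_input E w s ->
  (forall a : 'I_n, arr s tROW a = a * n) ->
  (forall a b : 'I_n, arr s tCL (a * n + b) = (a == b)) ->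
  (forall i, arr s tDEG i = 0) ->
  has_graph (exec p_edges s) /\ cost p_edges s <= max_cost p_edges * (size E).+1.
Proof.
move=> hin hrow hcl hdeg; rewrite /p_edges; set c := (tCL@@[_] <~ _;; _).
have [||] := @for_edgeP _ _ _ c s (fun p s => [/\ forall a : 'I_n, arr s tROW a = a * n,
      forall a b : 'I_n, arr s tCL (a * n + b) = dominates p a b,
      forall a : 'I_n, arr s tDEG a = degree p a &
      forall (a : 'I_n) k, k < degree p a ->
        arr s tNB (a * n + k) = nth 0 [seq val b | b <- nbrs p a] k]) hin isT isT.
- by split=> // a b; rewrite hcl /dominates /adj orbF.
- move=> p [a b] r s' hE fr [hrow' hcl' hdeg' hnb'].
  (* Every prefix is simple, so its degrees stay below n and no row of [tNB] overflows its n
     cells. *)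
  have hp : simple_edges (rcons p (a, b)).
    by move: simpleE; rewrite hE -cat_rcons => /simple_catl.
  have hp' : simple_edges p by move: hp; rewrite -cats1 => /simple_catl.
  have ab : a != b.
    by case/andP: hp => /allP/(_ (a, b)); rewrite mem_rcons mem_head => /(_ isT).
  have nab : ((a : nat) == b) = false by apply/negbTE.
  have dg x : degree p x < n by apply: degree_lt.
  (* All updates of one edge at once. Since [a] and [b] differ, the update at [a] does not affect
     the degree read at [b]. *)
  have s2E : forall t, t \in [:: tROW; tCL; tDEG; tNB] -> 
     arr (exec c (setr vB b (setr vA a (setr vJ (size p) s')))) t =
     (if t == tROW then arr s' tROW else
      if t == tCL then upd (upd (arr s' tCL) (a * n + b) 1) (b * n + a) 1 else
      if t == tDEG then upd (upd (arr s' tDEG) a (degree p a).+1) b (degree p b).+1 else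
      upd (upd (arr s' tNB) (a * n + degree p a) b) (b * n + degree p b) a).
    move=> t; rewrite !inE => /or4P[] /eqP-> //=;
    by rewrite /upd /= ?(eq_sym (b : nat)) ?nab !(hrow', hdeg') ?addn1.
  split.
  + by move=> x; rewrite s2E.
  + move=> x y; rewrite s2E //= /upd !index_eq // hcl' dominates_rcons /=.
    rewrite !(eq_sym (x : nat)) !(eq_sym (y : nat)) -!val_eqE /=.
    by case: (_ && _); case: (_ && _); rewrite ?orbT ?orbF.
  + move=> x; rewrite s2E //= /upd /degree nbrs_rcons !size_cat -!val_eqE /= -/(degree p x) hdeg'.
    rewrite !(eq_sym (x : nat)); case: (altP (b =P x)) => [<-|nbx].
      by rewrite eqxx nab addn1.
    case: (altP (a =P x)) => [<-|nax]; first by rewrite eq_sym eqxx nab addn1.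
    by rewrite !ifN // addn0.
  + move=> x k hk; have hkn : k < n := ltn_trans hk (degree_lt _ hp).
    move: hk; rewrite s2E //= /upd !index_eq // /degree nbrs_rcons map_cat nth_cat !size_cat size_map /=.
    rewrite -/(degree p x) -!val_eqE /= !(eq_sym (x : nat)).
    case: (altP (b =P x)) => [<-|nbx].
      rewrite eqxx nab /= add0n addn1 ltnS leq_eqVlt -/(degree p b) => /orP[/eqP->|hk].
        by rewrite eqxx ltnn subnn.
      by rewrite hk ltn_eqF //= hnb'.
    have nbx' : ((b : nat) == x) = false by apply/negbTE.
    rewrite nbx' /=; case: (altP (a =P x)) => [ax|nax].
      rewrite -ax eqxx /= addn1 ltnS leq_eqVlt -/(degree p a) => /orP[/eqP->|hk].
        by rewrite eqxx ltnn subnn.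
      by rewrite hk ltn_eqF //= hnb'.
    have nax' : ((a : nat) == x) = false by apply/negbTE.
    by rewrite nax' /= !addn0 => hk; rewrite hk hnb'.
move=> [hrow' hcl' hdeg' hnb'] hc; split=> //; split=> //.
by apply: (has_input_frame (exec_frame _ s)) hin.
Qed.

End Graph.

(** * Full and good vertices, minimum degree, and the case where all vertices are good *)

Section Phases.
Variables (n : nat) (E : edge_list n) (w : 'I_n -> nat).
Hypothesis simpleE : simple_edges E.

Lemma has_graph_setr x a s : x != vN -> x != vM -> has_graph E w s -> has_graph E w (setr x a s).
Proof.
move=> h1 h2; apply: (has_graph_frame (exec_frame (x <~ #a) s)).
by rewrite /= !inE !(eq_sym _ x) h1 h2.
Qed.

Lemma eval_closed_nb s (x y : nat) (a b : 'I_n) : has_graph E w s -> reg s x = a -> reg s y = b ->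
  eval s (closed_nb x y) = dominates E a b.
Proof. by case=> _ [hr hc _ _] ha hb; rewrite /= ha hb hr hc. Qed.

Definition keeps_graph c :=
  [&& vN \notin rmod c, vM \notin rmod c & all (fun t => t \notin amod c) [:: tIN; tROW; tCL; tDEG; tNB]].

Lemma for_edge_graph c s (J : edge_list n -> state -> Prop) :
  has_graph E w s -> keeps_graph c -> loop_free c -> J [::] s ->
  (forall p (a b : 'I_n) r s' (s3 := setr vB b (setr vA a (setr vJ (size p) s'))),
     E = p ++ (a, b) :: r -> has_graph E w s3 -> reg s3 vA = a -> reg s3 vB = b ->
     frame (for_edge c) s s3 -> J p s' -> J (rcons p (a, b)) (exec c s3)) ->
  J E (exec (for_edge c) s) /\ cost (for_edge c) s <= max_cost (for_edge c) * (size E).+1.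
Proof.
move=> hg hk lf J0 Jk; have := hk => /and5P[h1 h2 h3 h4 h5].
apply: (@for_edgeP _ _ _ _ _ _ (proj1 hg)) => // [|p [a b] r s' hE fr ih]; first by rewrite h1 h2 h3.
have hg' : has_graph E w s' by apply: (has_graph_frame fr) hg; rewrite /= !inE.
apply: (Jk p a b r) => //.
split=> [x hx|t ht] /=; last by rewrite fr.2.
by move: (hx) => /=; rewrite !inE !negb_or /upd => /and4P[/negbTE-> /negbTE-> /negbTE-> _]; rewrite fr.1.
Qed.

Lemma p_full_ok s : has_graph E w s ->
  (forall v : 'I_n, arr (exec p_full s) tFULL v = full E v /\ arr (exec p_full s) tGOOD v = full E v) /\
  cost p_full s <= max_cost p_full * (n.+1 * (size E).+1).
Proof.
move=> hg; have hn : reg s vN = n by case: hg => -[].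
set c := for_edge p_full_body.
set body := (vF <~ #1;; c;; tFULL@@[vV] <~ vF;; tGOOD@@[vV] <~ vF).
have := @for_rule vV vN body s (fun k t s => t <= max_cost body * (size E).+1 * k /\
  forall v : 'I_n, v < k -> arr s tFULL v = full E v /\ arr s tGOOD v = full E v).
case.
- by rewrite muln0.
- move=> k t s'; rewrite eval_var hn => hk fr [ht ih].
  pose v := Ordinal hk.
  have hg' : has_graph E w s' by exact: (has_graph_frame fr).
  set s1 := exec (vF <~ #1) (setr vV k s').
  have hg1 : has_graph E w s1 by do 2 apply: has_graph_setr => //.
  have [||hF hc] := @for_edge_graph p_full_body s1 (fun p s => reg s vF =
     all (fun e => dominates E v e.1 == dominates E v e.2) p) hg1 isT isT.
  + by [].
  + move=> p a b r s2 s3 hE hg3 ha hb fr3 ih2.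
    have hv : reg s3 vV = v by rewrite fr3.1.
    rewrite exec_when -cats1 all_cat [all _ [:: _]]/= andbT.
    rewrite [eval _ _](_ : _ = (dominates E v a - dominates E v b) + (dominates E v b - dominates E v a)); last first.
      by rewrite -(eval_closed_nb hg3 hv ha) -(eval_closed_nb hg3 hv hb).
    by move: ih2 => /=; case: (dominates E v a); case: (dominates E v b) => /=; rewrite /upd /= ?andbT ?andbF.
  have fr4 := exec_frame c s1.
  set s4 := exec c s1 in hF fr4.
  have hv4 : reg s4 vV = k by rewrite fr4.1.
  split.
  + rewrite [cost body _](_ : _ = cost (vF <~ #1) s1 + (cost c s1 +
      cost (tFULL@@[vV] <~ vF;; tGOOD@@[vV] <~ vF) s4)) //.
    have := @cost_loop_free (tFULL@@[vV] <~ vF;; tGOOD@@[vV] <~ vF) s4 isT.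
    have := @cost_loop_free (vF <~ #1) s1 isT.
    rewrite (_ : max_cost body = max_cost (vF <~ #1) + (max_cost c +
      max_cost (tFULL@@[vV] <~ vF;; tGOOD@@[vV] <~ vF))) // in ht *.
    move: hc ht; rewrite -/c.
    move: (max_cost _) (max_cost c) (max_cost _) (cost _ _) (cost c s1) (cost _ _) => *; nia.
  + move=> u; rewrite ltnS leq_eqVlt => hu.
    rewrite [exec body _](_ : _ = exec (tFULL@@[vV] <~ vF;; tGOOD@@[vV] <~ vF) s4) //.
    rewrite /= /upd /= hv4; case: (altP (val u =P k)) hu => [e _|_ /= hu]; last first.
      by rewrite !fr4.2 //; apply: ih.
    by rewrite hF; have -> : u = v by apply: val_inj.
move=> t [[ht hv]]; rewrite eval_var hn => hc; split; first by move=> v; apply: hv; rewrite eval_var hn.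
rewrite {}hc; move: ht; rewrite eval_var hn (_ : max_cost p_full = 10 + max_cost body) //.
move: (max_cost _) => K; rewrite [esize _]/=; nia.
Qed.

Lemma p_good_ok s : has_graph E w s ->
  (forall v : 'I_n, arr s tFULL v = full E v) -> (forall v : 'I_n, arr s tGOOD v = full E v) ->
  (forall v : 'I_n, (arr (exec p_good s) tGOOD v != 0) = good E v) /\
  cost p_good s <= max_cost p_good * (size E).+1.
Proof.
move=> hg hf hg0; rewrite /p_good; set c := (tGOOD@@[vA] <~ _;; _).
have [||hJ hc] := @for_edge_graph c s (fun p s => forall v : 'I_n, (arr s tGOOD v != 0) =
  (full E v || has (fun q => full E q) (nbrs p v))) hg isT isT.
- by move=> v; rewrite hg0 orbF; case: (full E v).
- move=> p a b r s' s3 hE hg3 ha hb fr ih v.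
  have ab : a != b.
    case/andP: simpleE => /allP/(_ (a, b)) h _; apply: h.
    by rewrite hE mem_cat inE eqxx orbT.
  have fE (x : 'I_n) : arr s3 tFULL x = full E x by rewrite fr.2.
  have -> : arr (exec c s3) tGOOD v = if v == b then arr s3 tGOOD b + full E a else
      if v == a then arr s3 tGOOD a + full E b else arr s3 tGOOD v.
    have nba : ((b : nat) == a) = false by rewrite eq_sym; apply/negbTE.
    move: (fE a) (fE b); rewrite /= /upd /= => -> ->.
    by rewrite nba.
  have iv (x : 'I_n) := ih x : (arr s3 tGOOD x != 0) = _.
  rewrite nbrs_rcons !has_cat /= !(eq_sym v); case: (altP (b =P v)) => [<-|nbv].
    by rewrite (negbTE ab) /= orbF orbA -iv addn_eq0 negb_and eqb0 negbK.
  case: (altP (a =P v)) => [<-|nav].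
    by rewrite /= !orbF orbA -iv addn_eq0 negb_and eqb0 negbK.
  by rewrite /= !orbF iv.
split=> // v; rewrite hJ; apply/orP/existsP => [[fv|/hasP[q]]|[q /andP[fq qv]]].
- by exists v; rewrite fv dom_refl.
- by rewrite mem_nbrs => qv fq; exists q; rewrite fq adj_dom // adjC.
- case: (altP (q =P v)) => [<-|nqv]; first by left.
  by right; apply/hasP; exists q => //; rewrite mem_nbrs adjC dom_adj.
Qed.

(** [vMin] starts at n, above every degree, so the final value n signals that all vertices are
    good. *)
Lemma p_min_ok s (s' := exec p_min s) : has_graph E w s ->
  (forall v : 'I_n, (arr s tGOOD v != 0) = good E v) ->
  (reg s' vMin = n /\ (forall y, good E y) \/
   exists x : 'I_n, [/\ reg s' vW = x, reg s' vMin = degree E x, ~~ good E x &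
      forall y, ~~ good E y -> degree E x <= degree E y]) /\
  cost p_min s <= max_cost p_min * n.+1.
Proof.
rewrite {}/s' => hg hgood; rewrite /p_min exec_seq cost_seq.
set c1 := (vMin <~ vN); set s1 := exec c1 s; set c := CIf _ _ _.
have hn : reg s vN = n by case: hg => -[].
have hg1 : has_graph E w s1 by exact: has_graph_setr.
have := @for_loop_free vV vN c s1 (fun k s =>
  reg s vMin = n /\ (forall y : 'I_n, y < k -> good E y) \/
   exists x : 'I_n, [/\ reg s vW = x, reg s vMin = degree E x, ~~ good E x &
      forall y : 'I_n, y < k -> ~~ good E y -> degree E x <= degree E y]) isT.
case.
- by left; split.
- move=> k s2; rewrite eval_var [reg s1 _]/= /upd /= hn => hk fr ih; pose v := Ordinal hk.
  have gE : (arr s2 tGOOD k == 0) = ~~ good E v by rewrite fr.2 // -(hgood v) negbK.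
  have dE : arr s2 tDEG k = degree E v.
    by have [_ [_ _ hd _]] := has_graph_frame fr isT hg1; apply: (hd v).
  have split_lt (y : 'I_n) : y < k.+1 -> y = v \/ y < k.
    by rewrite ltnS leq_eqVlt => /orP[/eqP e|]; [left; apply: val_inj | right].
  rewrite /= /upd /= gE dE; case: ifP => gv; last first.
    move/negbT: gv; rewrite negbK => gv.
    case: ih => [[hm hy]|[x [hx hm gx hy]]]; [left|right; exists x]; split=> //= y /split_lt[->|] //.
    - exact: hy.
    - by rewrite gv.
    - exact: hy.
  case: eqP => hcmp.
    case: ih => [[hm hy]|[x [hx hm gx hy]]].
      by move: hcmp (degree_lt v simpleE); rewrite hm; lia.
    right; exists x; split=> //= y /split_lt[->|] //; last exact: hy.
    by move: hcmp; rewrite hm; lia.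
  right; exists v; split=> //= y /split_lt[->|] // yk ny.
  case: ih => [[hm hy]|[x [hx hm gx hy]]]; first by rewrite hy in ny.
  by apply: leq_trans (hy y yk ny); move: hcmp; rewrite hm; lia.
have hn1 : reg s1 vN = n by rewrite -[RHS]hn.
rewrite eval_var hn1 => hJ hc; split.
  case: hJ => [[hm hy]|[x [hx hm gx hy]]]; [left|right; exists x]; split=> // y;
  exact: (hy _ (ltn_ord _)).
rewrite (_ : max_cost (c1;; _) = max_cost c1 + max_cost (CFor vV vN c)) //.
have := @cost_loop_free c1 s isT.
move: (max_cost c1) (max_cost _) hc => K1 K2; nia.
Qed.

(** The invariant keeps the hypotheses of [full_ed_optimal], with non-adjacency required only along
    the processed edges. *)
Lemma p_universal_ok s (s' := exec p_universal s) : has_graph E w s ->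
  (forall v : 'I_n, arr s tFULL v = full E v) -> arr s tOUT 0 = 0 -> (forall y, good E y) ->
  [/\ arr s' tOUT 0 = 0,
      efficient_dom E [set v : 'I_n | arr s' tOUT v.+1 != 0],
      forall D, efficient_dom E D -> weight w [set v : 'I_n | arr s' tOUT v.+1 != 0] <= weight w D &
      cost p_universal s <= max_cost p_universal * (n.+1 * (size E).+1)].
Proof.
rewrite {}/s' => hg hfull ho hgood; rewrite /p_universal exec_seq cost_seq.
set c1 := CFor _ _ _; set s1 := exec c1 s; set c := when _ _.
have hn : reg s vN = n by case: hg => -[].
have [||[h0 hv] hc1] := @for_loop_free vV vN (tOUT@@[vV [+] #1] <~ tFULL@[vV]) s (fun k s => arr s tOUT 0 = 0 /\
  forall v : 'I_n, v < k -> arr s tOUT v.+1 = full E v) isT.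
- by split.
- move=> k s2; rewrite eval_var hn => hk fr [h0 hv]; rewrite /= /upd /= addn1 /=; split=> // v.
  rewrite ltnS leq_eqVlt eqSS; case: eqP => [e _|_ /= hvk]; last exact: hv.
  by rewrite -hfull e -fr.2.
rewrite eval_var hn -/c1 -/s1 in h0 hv hc1.
have hg1 : has_graph E w s1 by apply: (has_graph_frame (exec_frame c1 s)).
have hin s2 (v : 'I_n) : has_graph E w s2 -> arr s2 tIN v = w v by case=> -[].
pose out s (v : 'I_n) := arr s tOUT v.+1 != 0.
have [||[k0 kf kw ke] hc2] := @for_edge_graph c s1 (fun p s => [/\ arr s tOUT 0 = 0,
   forall v, out s v -> full E v,
   forall v, full E v -> exists q, [/\ out s q, dominates E q v & w q <= w v] &
   forall a b, (a, b) \in p -> ~~ (out s a && out s b)]) hg1 isT isT.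
- split=> // v; first by rewrite /out hv //; case: (full E v).
  by move=> fv; exists v; rewrite /out hv // fv dom_refl.
- move=> p a b r s2 s3 hE hg3 ha hb fr [i0 iF iw ie].
  have hab : adj E a b by rewrite /adj hE mem_cat inE eqxx orbT.
  have oa : arr s2 tOUT (reg s3 vA).+1 != 0 = out s2 a by rewrite ha.
  have ob : arr s2 tOUT (reg s3 vB).+1 != 0 = out s2 b by rewrite hb.
  have : exec c s3 = if out s2 a && out s2 b then
      seta tOUT (if w b < w a then a.+1 else b.+1) 0 s3 else setr vNull 0 s3.
    rewrite /c exec_when [eval _ _](_ : _ = arr s2 tOUT (reg s3 vA).+1); last by rewrite /= addn1.
    move: oa; case: eqP => [_ <- //|_ <-]; rewrite exec_when [eval _ _](_ : _ = arr s2 tOUT (reg s3 vB).+1); last by rewrite /= addn1.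
    move: ob; case: eqP => [_ <- //|_ <-].
    have wE : eval s3 (tIN@[vA] [-] tIN@[vB]) = w a - w b.
      by rewrite -(hin s3 a hg3) -(hin s3 b hg3) -ha -hb.
    have -> : (w b < w a) = (eval s3 (tIN@[vA] [-] tIN@[vB]) != 0).
      by rewrite wE subn_eq0 ltnNge.
    by rewrite [exec _ _]/=; case: eqP => _ /=; rewrite addn1.
  move=> ->; case: ifP => hout; last first.
    split=> // a' b'; rewrite mem_rcons inE => /orP[/eqP[-> ->]|]; last exact: ie.
    by rewrite -[out _ a]/(out s2 a) -[out _ b]/(out s2 b) hout.
  (* [z] is the deleted end, which is [b] on a tie, and [y] the surviving one. *)
  have [z [y [-> oy yz wyz hz]]] : exists z y : 'I_n,
      [/\ (if w b < w a then a.+1 else b.+1) = z.+1, out s2 y, adj E y z, w y <= w z &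
          z \in [:: a; b]].
    case/andP: hout => oa' ob'; case: ltnP => hw; [exists a, b | exists b, a];
    by split; rewrite ?inE ?eqxx ?orbT // ?[adj E b a]adjC // ltnW.
  set s4 := seta _ _ _ _.
  have oE v : out s4 v = (v != z) && out s2 v.
    by rewrite /out /= /upd eqSS (_ : ((v : nat) == z) = (v == z)) //; case: (v == z).
  split.
  + exact: i0.
  + by move=> v; rewrite oE => /andP[_]; apply: iF.
  + move=> v fv; have [q [oq qv wq]] := iw v fv.
    case: (altP (q =P z)) => [eq|nq]; last by exists q; rewrite oE nq.
    (* [y] takes over what [z] represented: it is full and adjacent to [z], so it dominates all that
       [z] dominates, at no greater weight. *)
    exists y; rewrite oE oy andbT; split.
    * by apply: contraTneq yz => ->; rewrite adj_irr.
    * by rewrite eq in qv; apply: full_subset (iF _ oy) (adj_dom yz) qv.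
    * by apply: leq_trans wyz _; rewrite -eq.
  + move=> a' b'; rewrite !oE mem_rcons inE => /orP[/eqP[-> ->]|].
      by move: hz; rewrite !inE => /orP[] /eqP <-; rewrite eqxx ?andbF.
    by move/ie; apply: contra => /andP[/andP[_ ->] /andP[_ ->]].
set s2 := exec (for_edge c) s1 in k0 kf kw ke.
have [|||ed opt] := @full_ed_optimal _ E w [set v | out s2 v] hgood.
- by move=> q; rewrite inE; apply: kf.
- move=> p q; rewrite !inE => op oq; apply/negP => /orP[] /ke; by rewrite op oq.
- by move=> v /kw[q [oq qv wq]]; exists q; rewrite inE.
split=> //.
rewrite (_ : max_cost (c1;; _) = max_cost c1 + max_cost (for_edge c)) //.
by move: (max_cost c1) (max_cost _) hc1 hc2 => K1 K2; nia.
Qed.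

End Phases.

Lemma adj_rcons n (p : edge_list n) (a b x y : 'I_n) :
  adj (rcons p (a, b)) x y = [|| adj p x y, (a == x) && (b == y) | (b == x) && (a == y)].
Proof.
rewrite -!mem_nbrs nbrs_rcons !mem_cat /=; congr [|| _, _ | _];
by case: eqP => _; rewrite ?inE ?in_nil // eq_sym.
Qed.

(* Array entries are shifted by one: 0 means that no witness has been found. *)
Definition witness n (E p : edge_list n) (Q : rel 'I_n) (R : nat -> nat) :=
  forall y : 'I_n, R y = 0 /\ (forall x, adj p x y -> ~~ Q x y) \/
    exists x : 'I_n, [/\ R y = x.+1, adj E x y & Q x y].

Lemma witness_rcons n (E p : edge_list n) Q (R R' : nat -> nat) (a b : 'I_n) : adj E a b ->
  witness E p Q R ->
  (forall y : 'I_n, R' y = if (y == b) && Q a b then a.+1 else if (y == a) && Q b a then b.+1 else R y) ->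
  witness E (rcons p (a, b)) Q R'.
Proof.
move=> hab hw hR y; rewrite hR.
case: ifP => [/andP[/eqP-> q]|n1]; first by right; exists a.
case: ifP => [/andP[/eqP-> q]|n2]; first by right; exists b; rewrite adjC.
case: (hw y) => [[r0 hx]|hx]; [left | by right].
split=> // x; rewrite adj_rcons => /or3P[/hx //|/andP[/eqP ex /eqP ey]|/andP[/eqP ex /eqP ey]].
- by move: n1; rewrite -ex -ey eqxx /= => ->.
- by move: n2; rewrite -ex -ey eqxx /= => ->.
Qed.

Lemma witnessP n (E : edge_list n) Q R (y : 'I_n) : witness E E Q R ->
  (R y != 0) = [exists x, adj E x y && Q x y].
Proof.
move/(_ y) => [[-> h]|[x [-> h1 h2]]] /=.
  by symmetry; apply/negbTE/existsPn => x; rewrite negb_and -implybE; apply/implyP/h.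
by symmetry; apply/existsP; exists x; rewrite h1.
Qed.

Section Levels.
Variables (n : nat) (E : edge_list n) (w : 'I_n -> nat).
Hypothesis simpleE : simple_edges E.

(** On edges, [exits] and [to_level3] describe the passages from distance 1 to 2 and from distance 2
    to 3. *)
Definition exits v : rel 'I_n := fun a b => dominates E v a && ~~ dominates E v b.
Definition to_level3 v : rel 'I_n :=
  fun a b => [&& level2 E v a, ~~ dominates E v b & ~~ level2 E v b].

Lemma p_levels_ok s (v : 'I_n) (s' := exec p_levels s) : has_graph E w s -> reg s vV = v ->
  [/\ witness E E (exits v) (arr s' tP2),
      witness E E (to_level3 v) (arr s' tP3) &
      cost p_levels s <= max_cost p_levels * (n + size E).+1].
Proof.
rewrite {}/s' => hg hv; rewrite /p_levels !exec_seq !cost_seq.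
set c1 := CFor _ _ _; set s1 := exec c1 s; set c2 := CIf (closed_nb vV vA) _ _; set c3 := (when tP2@[vA] _;; _).
have hn : reg s vN = n by case: hg => -[].
have [||hJ1 hc1] := @for_loop_free vY vN (tP2@@[vY] <~ #0;; tP3@@[vY] <~ #0) s (fun k s =>
  forall x : 'I_n, x < k -> arr s tP2 x = 0 /\ arr s tP3 x = 0) isT.
- by [].
- move=> k s2 hk fr ih x; rewrite ltnS leq_eqVlt /= /upd /=.
  by case: eqP => //= _; apply: ih.
rewrite eval_var hn -/c1 -/s1 in hJ1 hc1.
have fr1 : frame c1 s s1 := exec_frame c1 s.
have hg1 : has_graph E w s1 by apply: (has_graph_frame fr1).
have hv1 : reg s1 vV = v by rewrite fr1.1.
have [||hJ2 hc2] := @for_edge_graph _ E w c2 s1 (fun p s => witness E p (exits v) (arr s tP2)) hg1 isT isT.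
- by move=> y; left; split=> //; have [] := hJ1 y (ltn_ord y).
- move=> p a b r s' s3 hE hg3 ha hb fr ih.
  have hab : adj E a b by rewrite /adj hE mem_cat inE eqxx orbT.
  have hv3 : reg s3 vV = v by rewrite fr.1.
  apply: (witness_rcons hab ih) => y.
  have eE : exec c2 s3 = if eval s3 (closed_nb vV vA) == 0 then
      if eval s3 (closed_nb vV vB) == 0 then setr vNull 0 s3 else seta tP2 (reg s3 vA) (reg s3 vB + 1) s3
      else if eval s3 (closed_nb vV vB) == 0 then seta tP2 (reg s3 vB) (reg s3 vA + 1) s3
      else setr vNull 0 s3.
    by [].
  rewrite eE (eval_closed_nb hg3 hv3 ha) (eval_closed_nb hg3 hv3 hb) ha hb /exits.
  by case: (dominates E v a); case: (dominates E v b); rewrite /= /upd ?andbT ?andbF ?addn1.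
have fr2 : frame (for_edge c2) s1 _ := exec_frame _ s1.
set s2 := exec (for_edge c2) s1 in hJ2 fr2 *.
have hg2 : has_graph E w s2 by apply: (has_graph_frame fr2).
have hv2 : reg s2 vV = v by rewrite fr2.1.
(* Valid only after the full pass; the second pass relies on it and leaves [tP2] alone. *)
have l2 (x : 'I_n) : (arr s2 tP2 x != 0) = level2 E v x.
  rewrite (witnessP x hJ2) /level2 /exits.
  apply/existsP/andP => [[u /and3P[ux vu vx]]|[vx /existsP[u /andP[vu ux]]]].
    by split=> //; apply/existsP; exists u; rewrite ux; have [-> _] := level2I vu vx ux.
  by exists u; rewrite ux vx adj_dom.
have [||hJ3 hc3] := @for_edge_graph _ E w c3 s2 (fun p s => witness E p (to_level3 v) (arr s tP3)) hg2 isT isT.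
- by move=> y; left; split=> //; have [_] := hJ1 y (ltn_ord y); rewrite fr2.2.
- move=> p a b r s' s3 hE hg3 ha hb fr ih.
  have hab : adj E a b by rewrite /adj hE mem_cat inE eqxx orbT.
  have hv3 : reg s3 vV = v by rewrite fr.1.
  have l3 (x : 'I_n) : (arr s3 tP2 x != 0) = level2 E v x by rewrite fr.2.
  apply: (witness_rcons hab ih) => y.
  (* An edge is handled once per orientation; both halves follow one schema. *)
  pose half z z' := when tP2@[z] (when (#1 [-] (closed_nb vV z' [+] tP2@[z'])) (tP3@@[z'] <~ z [+] #1)).
  have cE t (z z' : nat) (x x' : 'I_n) : has_graph E w t -> reg t vV = v ->
      (forall x : 'I_n, (arr t tP2 x != 0) = level2 E v x) -> reg t z = x -> reg t z' = x' ->
      exec (half z z') t = if to_level3 v x x' then seta tP3 x' x.+1 t else setr vNull 0 t.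
    move=> hgt hvt lt hz hz'; rewrite /half exec_when [eval _ _]/= hz /to_level3.
    have := lt x; case: eqP => _ <- //; rewrite exec_when.
    rewrite [eval _ _](_ : _ = 1 - (dominates E v x' + arr t tP2 x')); last first.
      by rewrite -(eval_closed_nb hgt hvt hz') /= hz'.
    rewrite -lt; case: (dominates E v x') => //; case: (arr t tP2 x') => //=.
    by rewrite hz hz' addn1.
  have e1 := cE s3 vA vB a b hg3 hv3 l3 ha hb.
  have fr4 := exec_frame (half vA vB) s3.
  have hg4 := has_graph_frame fr4 isT hg3.
  set s4 := exec (half vA vB) s3 in e1 fr4 hg4.
  have hv4 : reg s4 vV = v by rewrite fr4.1.
  have l4 (x : 'I_n) : (arr s4 tP2 x != 0) = level2 E v x by rewrite fr4.2.
  have hb4 : reg s4 vB = b by rewrite fr4.1.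
  have ha4 : reg s4 vA = a by rewrite fr4.1.
  have e2 := cE _ vB vA b a hg4 hv4 l4 hb4 ha4.
  rewrite [exec c3 s3](_ : _ = exec (half vB vA) s4) // e2 e1.
  have ab : a != b by apply: contraTneq hab => ->; rewrite adj_irr.
  case: (altP (y =P b)) => [->|nyb] /=.
    rewrite eq_sym (negbTE ab) /=.
    have nba : ((b : nat) == a) = false by apply/negbTE; rewrite eq_sym.
    by case: (to_level3 v b a); case: (to_level3 v a b); rewrite /= /upd /= ?eqxx ?nba.
  have nyb' : ((y : nat) == b) = false by apply/negbTE.
  by case: (to_level3 v b a); case: (to_level3 v a b); rewrite /= /upd /= ?nyb' ?andbT ?andbF.
split=> //.
- by rewrite (exec_frame (for_edge c3) s2).2.
- rewrite (_ : max_cost _ = max_cost c1 + (max_cost (for_edge c2) + max_cost (for_edge c3))) //.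
  by move: (max_cost c1) (max_cost _) (max_cost _) hc1 hc2 hc3 => K1 K2 K3; nia.
Qed.

End Levels.

(** * Testing one pair in linear time *)

Section Test.
Variables (n : nat) (E : edge_list n) (w : 'I_n -> nat).
Hypothesis simpleE : simple_edges E.

Lemma p_init_test_ok s (v u x d : 'I_n) (s' := exec p_init_test s) : has_graph E w s ->
  reg s vV = v -> reg s vU = u -> reg s vX = x -> reg s vD = d ->
  (forall y : 'I_n, [/\ arr s' tZ y = (y \in far E v u x d), arr s' tDD y = (y \in far E v u x d) &
     arr s' tCOV y = 0]) /\ cost p_init_test s <= max_cost p_init_test * n.+1.
Proof.
rewrite {}/s' => hg hv hu hx hd; have hn : reg s vN = n by case: hg => -[].
have [||hJ hc] := @for_loop_free vY vN (tZ@@[vY] <~ #1 [-] (closed_nb vV vY [+] closed_nb vU vY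
     [+] closed_nb vX vY [+] closed_nb vD vY);; tDD@@[vY] <~ tZ@[vY];; tCOV@@[vY] <~ #0) s
  (fun k s => forall y : 'I_n, y < k -> [/\ arr s tZ y = (y \in far E v u x d),
     arr s tDD y = (y \in far E v u x d) & arr s tCOV y = 0]) isT.
- by [].
- move=> k s2; rewrite eval_var hn => hk fr ih; pose z := Ordinal hk; set s3 := setr vY k s2.
  have hg2 : has_graph E w s2 by apply: (has_graph_frame fr) hg.
  have hg3 : has_graph E w s3 by apply: has_graph_setr.
  have hz : reg s3 vY = z by [].
  set e := _ [-] _; have -> : forall c, exec (tZ@@[vY] <~ e;; c) s3 = exec c (seta tZ k (eval s3 e) s3) by [].
  have -> : eval s3 e = (z \in far E v u x d).
    have -> : eval s3 e = 1 - (dominates E v z + dominates E u z + dominates E x z + dominates E d z).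
      have hv3 : reg s3 vV = v by rewrite -hv -fr.1.
      have hu3 : reg s3 vU = u by rewrite -hu -fr.1.
      have hx3 : reg s3 vX = x by rewrite -hx -fr.1.
      have hd3 : reg s3 vD = d by rewrite -hd -fr.1.
      by rewrite -(eval_closed_nb hg3 hv3 hz) -(eval_closed_nb hg3 hu3 hz)
        -(eval_closed_nb hg3 hx3 hz) -(eval_closed_nb hg3 hd3 hz).
    rewrite /far inE.
    by do 4!case: (dominates _ _ z).
  move=> y; rewrite ltnS leq_eqVlt /= /upd /= eqxx; case: eqP => [e1 _|_ /= hy] /=; last exact: ih.
  by have -> : y = z by apply: val_inj.
rewrite eval_var hn in hJ hc; split=> // y; exact: hJ.
Qed.

Lemma scan_ok s (z : 'I_n) (Z : {set 'I_n}) (s' := exec scan s) : has_graph E w s -> reg s vY = z ->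
  (forall y : 'I_n, arr s tZ y = (y \in Z)) ->
  [/\ forall y : 'I_n, arr s' tCOV y = arr s tCOV y + adj E z y,
      reg s' vTwo = reg s vTwo /\ (forall y, y \in Z -> ~~ adj E z y) \/
      reg s' vTwo = 1 /\ (exists2 y, y \in Z & adj E z y) &
      cost scan s <= max_cost scan * (degree E z).+1].
Proof.
rewrite {}/s' => hg hz hZ.
have hdeg : eval s (tDEG@[vY]) = degree E z by case: hg => _ [_ _ hd _]; rewrite /= hz hd.
rewrite /scan; set c := (vB <~ _;; _).
have := @for_loop_free vK (tDEG@[vY]) c s (fun k s2 =>
  (forall y : 'I_n, arr s2 tCOV y = arr s tCOV y + (y \in take k (nbrs E z))) /\
  (reg s2 vTwo = reg s vTwo /\ (forall y, y \in Z -> y \notin take k (nbrs E z)) \/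
   reg s2 vTwo = 1 /\ (exists2 y, y \in Z & adj E z y))) isT.
case.
- by rewrite take0; split; [move=> y; rewrite addn0 | left].
- move=> k s2; rewrite hdeg => hk fr [hcov htwo].
  have hg2 : has_graph E w s2 by apply: (has_graph_frame fr) hg.
  pose b := nth z (nbrs E z) k.
  have bz : adj E z b by rewrite -mem_nbrs mem_nth.
  have eb : arr s2 tNB (z * n + k) = b.
    by case: hg2 => _ [_ _ _ ->] //; rewrite (nth_map z).
  have tk : take k.+1 (nbrs E z) = rcons (take k (nbrs E z)) b by rewrite -take_nth.
  (* Simplicity makes the neighbours distinct, so each count grows by at most 1 during a scan. *)
  have nb : b \notin take k (nbrs E z).
    by have := take_uniq k.+1 (uniq_nbrs z simpleE); rewrite tk rcons_uniq => /andP[].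
  have eE : exec c (setr vK k s2) = (let s3 := seta tCOV b (arr s2 tCOV b + 1) (setr vB b (setr vK k s2)) in
      if arr s2 tZ b == 0 then setr vNull 0 s3 else setr vTwo 1 s3).
    have hrow : arr s2 tROW (reg s2 vY) = z * n.
      by case: hg2 => _ [hr _ _ _]; rewrite fr.1 // hz hr.
    rewrite /c /= /upd /= hrow eb; done.
  have zb : arr s2 tZ b = (b \in Z) by rewrite fr.2.
  rewrite eE zb tk; split.
  + move=> y; rewrite mem_rcons inE.
    have -> : forall (b : bool) s3, arr (if (b : nat) == 0 then setr vNull 0 s3 else setr vTwo 1 s3) = arr s3.
      by case.
    rewrite /= /upd (_ : ((y : nat) == b) = (y == b)) //; case: eqP => [->|_] /=; last exact: hcov.
    by rewrite hcov (negbTE nb) addn0.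
  + case hb: (b \in Z) => /=; first by right; split=> //; exists b.
    rewrite /upd /=; case: htwo => -[h1 h2]; [left|right]; split=> // y hy.
    rewrite mem_rcons inE negb_or h2 // andbT.
    by apply: contraTneq hy => ->; rewrite hb.
rewrite hdeg take_size => -[hcov htwo] hc; split=> //.
- by move=> y; rewrite hcov mem_nbrs.
- by case: htwo => -[h1 h2]; [left|right]; split=> // y /h2; rewrite mem_nbrs.
Qed.

Lemma cost_when e c s : cost (when e c) s =
  esize e + 1 + (if eval s e == 0 then 2 else cost c s + 1).
Proof. by []. Qed.

Lemma visit_ok s (z : 'I_n) (Z : {set 'I_n}) (s' := exec visit s) : has_graph E w s -> reg s vY = z ->
  (forall y : 'I_n, arr s tZ y = (y \in Z)) ->
  [/\ reg s' vSum = reg s vSum + (degree E z).+1,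
      forall y : 'I_n, arr s' tCOV y = arr s tCOV y + dominates E z y,
      reg s' vTwo = reg s vTwo /\ (forall y, y \in Z -> ~~ adj E z y) \/
      reg s' vTwo = 1 /\ (exists2 y, y \in Z & adj E z y) &
      cost visit s <= max_cost visit * (degree E z).+1].
Proof.
rewrite {}/s' => hg hz hZ; rewrite /visit exec_seq cost_seq.
set c1 := (vSum <~ _;; _); set s1 := exec c1 s.
have fr1 : frame c1 s s1 := exec_frame c1 s.
have hg1 : has_graph E w s1 by apply: (has_graph_frame fr1) hg.
have hz1 : reg s1 vY = z by rewrite fr1.1.
have hZ1 (y : 'I_n) : arr s1 tZ y = (y \in Z) by rewrite fr1.2.
have hdeg : arr s tDEG z = degree E z by case: hg => _ [].
have [cov two hc] := scan_ok hg1 hz1 hZ1; split.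
- by rewrite (exec_frame scan s1).1 // /s1 /= /upd /= hz hdeg addn1 addnS.
- move=> y; rewrite cov /s1 /= /upd /= hz (_ : ((y : nat) == z) = (z == y)); last by rewrite eq_sym.
  rewrite /dominates; case: eqP => [<-|_] /=; last by [].
  by rewrite adj_irr // addn0.
- exact: two.
- rewrite (_ : max_cost (c1;; scan) = max_cost c1 + max_cost scan) //.
  have := @cost_loop_free c1 s isT.
  move: (max_cost c1) (max_cost _) hc => K1 K2; nia.
Qed.

(** [P] is the set of visited vertices. Costs are charged to [vSum]: a visit starts only while the
    sum is at most n and adds at most n, so it never exceeds 2 n and the loop is linear. *)
Lemma p_cover_ok s (Z D : {set 'I_n}) (s' := exec p_cover s) : has_graph E w s ->
  (forall y : 'I_n, arr s tZ y = (y \in Z)) ->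
  (forall y : 'I_n, (arr s tDD y != 0) = (y \in D)) ->
  (forall y : 'I_n, arr s tCOV y = 0) -> reg s vSum = 0 ->
  exists P : {set 'I_n},
  [/\ [/\ P \subset D, reg s' vSum = \sum_(z in P) (degree E z).+1 & reg s' vSum <= n -> P = D],
      forall y : 'I_n, arr s' tCOV y = \sum_(z in P) dominates E z y,
      reg s' vTwo = reg s vTwo /\ (forall z y, z \in P -> y \in Z -> ~~ adj E z y) \/
      reg s' vTwo = 1 /\ (exists z y, [/\ z \in D, y \in Z & adj E z y]) &
      cost p_cover s <= 4 * max_cost p_cover * n.+1].
Proof.
rewrite {}/s' => hg hZ hD hcov hsum; have hn : reg s vN = n by case: hg => -[].
set body := when tDD@[vY] (when (vN [+] #1 [-] vSum) visit).
have hcE : p_cover = CFor vY vN body by [].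
have := @for_rule vY vN body s (fun k t s2 => exists P : {set 'I_n},
  [/\ [/\ P \subset D, forall z, z \in P -> z < k,
       reg s2 vSum = \sum_(z in P) (degree E z).+1 &
       reg s2 vSum <= n -> forall z : 'I_n, z \in D -> z < k -> z \in P],
      forall y : 'I_n, arr s2 tCOV y = \sum_(z in P) dominates E z y,
      reg s2 vTwo = reg s vTwo /\ (forall z y, z \in P -> y \in Z -> ~~ adj E z y) \/
      reg s2 vTwo = 1 /\ (exists z y, [/\ z \in D, y \in Z & adj E z y]) &
      reg s2 vSum <= 2 * n /\ t <= max_cost body * (k + reg s2 vSum)]).
case.
- exists set0; split=> //.
  + by split; rewrite ?sub0set ?big_set0 // => z; rewrite inE.
  + by move=> y; rewrite big_set0 hcov.
  + by left; split=> // z y; rewrite inE.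
  + by rewrite hsum.
- move=> k t s2; rewrite eval_var hn => hk fr [P [[PD Pk Psum PDk] Pcov Ptwo [sum2 ht]]].
  pose z := Ordinal hk; set s3 := setr vY k s2.
  have hg2 : has_graph E w s2 by apply: (has_graph_frame fr) hg.
  have hg3 : has_graph E w s3 by apply: has_graph_setr.
  have hn3 : reg s3 vN = n by case: hg3 => -[].
  have dz : (arr s3 tDD k == 0) = (z \notin D) by rewrite -hD negbK /= fr.2.
  have K6 : 20 <= max_cost body by [].
  have KV : 20 + max_cost visit <= max_cost body by [].
  have e1 : (eval s3 (tDD@[vY]) == 0) = (z \notin D) by rewrite -dz.
  have e2 : (eval s3 (vN [+] #1 [-] vSum) == 0) = (n < reg s2 vSum).
    by rewrite -[eval _ _]/(reg s3 vN + 1 - reg s2 vSum) hn3 subn_eq0 addn1.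
  have skipped : (z \in D -> n < reg s2 vSum) -> exec body s3 = setr vNull 0 s3 /\ cost body s3 <= 20.
    move=> hz; rewrite /body exec_when cost_when e1; case: (boolP (z \in D)) => [/hz hz'|_].
      by rewrite exec_when cost_when e2 hz'.
    by [].
  case: (boolP ((z \in D) && (reg s2 vSum <= n))) => [/andP[zD hs]|hz]; last first.
    have [|-> hc] := skipped; first by move=> zD; move: hz; rewrite zD ltnNge.
    exists P; split=> //.
      split=> //; first by move=> y /Pk; apply: ltnW.
      move=> hs y yD; rewrite ltnS leq_eqVlt => /orP[/eqP e|]; last exact: PDk.
      by move: hz; rewrite (_ : z = y) ?yD //; [rewrite hs | apply: val_inj].
    split=> //; have -> : reg (setr vNull 0 s3) vSum = reg s2 vSum by [].
    by rewrite addSn mulnS addnC leq_add // (leq_trans hc).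
  have zP : z \notin P by apply/negP => /Pk; rewrite ltnn.
  have eE : exec body s3 = exec visit s3.
    by rewrite /body exec_when e1 zD exec_when e2 ltnNge hs.
  have cE : cost body s3 <= 20 + cost visit s3.
    rewrite /body cost_when e1 zD cost_when e2 ltnNge hs [esize (tDD@[_])]/= [esize (_ [-] _)]/= [~~ true]/=; lia.
  have hZ3 (y : 'I_n) : arr s3 tZ y = (y \in Z) by rewrite /= fr.2.
  have [vsum vcov vtwo vcost] := visit_ok hg3 (erefl (reg s3 vY) : reg s3 vY = z) hZ3.
  rewrite eE; exists (z |: P); split.
  + split.
    * by rewrite subUset sub1set zD.
    * by move=> y; rewrite in_setU1 => /orP[/eqP->//|/Pk/ltnW].
    * by rewrite vsum big_setU1 //= addnC -Psum.
    * move=> _ y yD; rewrite ltnS leq_eqVlt in_setU1 => /orP[/eqP e|hy].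
        by rewrite (_ : y = z) ?eqxx //; apply: val_inj.
      by rewrite PDk // orbT.
  + by move=> y; rewrite vcov big_setU1 //= addnC -Pcov.
  + case: vtwo => -[-> hv]; last first.
      by right; split=> //; have [y yZ zy] := hv; exists z, y.
    case: Ptwo => -[h1 h2]; [left | by right].
    by split=> // x y; rewrite in_setU1 => /orP[/eqP->|]; [apply: hv | apply: h2].
  + have := degree_lt z simpleE; rewrite vsum -[reg s3 vSum]/(reg s2 vSum).
    move: (max_cost body) (max_cost visit) (degree E z) ht KV vcost cE => K K' dd; nia.
rewrite eval_var hn => t [[P [[PD Pk Psum PDk] Pcov Ptwo [sum2 ht]]] hc].
exists P; split=> //.
  split=> // hs; apply/eqP; rewrite eqEsubset PD; apply/subsetP => z hz; exact: PDk.
rewrite hcE hc (_ : max_cost (CFor _ _ body) = 10 + max_cost body) // [esize _]/=.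
move: (max_cost _) ht => K ht; nia.
Qed.
End Test.

Lemma lt_ordS n (k : nat) (z y : 'I_n) : z = k :> nat -> (y < k.+1) = (y == z) || (y < k).
Proof. by move=> <-; rewrite ltnS leq_eqVlt. Qed.

Lemma sum_ltS n (k : nat) (z : 'I_n) (F : 'I_n -> nat) : z = k :> nat ->
  \sum_(y : 'I_n | y < k.+1) F y = F z + \sum_(y : 'I_n | y < k) F y.
Proof.
move=> hz; rewrite (bigD1 z) /=; last by rewrite (lt_ordS _ hz) eqxx.
congr (_ + _); apply: eq_bigl => y; rewrite (lt_ordS _ hz); case: eqP => //= [->|_].
  by rewrite hz ltnn.
by rewrite andbT.
Qed.

Section Search.
Variables (n : nat) (E : edge_list n) (w : 'I_n -> nat).
Hypothesis simpleE : simple_edges E.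

Lemma p_check_ok s (D : {set 'I_n}) (s' := exec p_check s) : has_graph E w s ->
  (forall y : 'I_n, (arr s tDD y != 0) = (y \in D)) -> reg s vWt = 0 ->
  [/\ (reg s' vOk != 0) = (reg s vOk != 0) && [forall y : 'I_n, arr s tCOV y == 1],
      reg s' vWt = weight w D &
      cost p_check s <= max_cost p_check * n.+1].
Proof.
rewrite {}/s' => hg hD h0; have hn : reg s vN = n by case: hg => -[].
set c := (when ((tCOV@[vY] [-] #1) [+] (#1 [-] tCOV@[vY])) (vOk <~ #0);;
              when tDD@[vY] (vWt <~ vWt [+] tIN@[vY])).
have hcE : p_check = CFor vY vN c by [].
have [||[hok hwt] hc] := @for_loop_free vY vN c s (fun k s2 =>
  (reg s2 vOk != 0) = (reg s vOk != 0) && [forall y : 'I_n, (y < k) ==> (arr s tCOV y == 1)] /\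
  reg s2 vWt = \sum_(y : 'I_n | y < k) (if y \in D then w y else 0)) isT.
- split; last by rewrite big1.
  by rewrite (_ : [forall y : 'I_n, (y < 0) ==> (arr s tCOV y == 1)]) ?andbT //; apply/forallP.
- move=> k s2; rewrite eval_var hn => hk fr [hok hwt]; pose z := Ordinal hk.
  have hw : arr s2 tIN z = w z by rewrite fr.2 //; case: hg => -[].
  have hd : (arr s2 tDD z == 0) = (z \notin D) by rewrite fr.2 // -hD negbK.
  have hcov : arr s2 tCOV k = arr s tCOV z by rewrite fr.2.
  rewrite (sum_ltS _ (erefl : z = k :> nat)) -hwt.
  have -> : [forall y : 'I_n, (y < k.+1) ==> (arr s tCOV y == 1)] =
      (arr s tCOV z == 1) && [forall y : 'I_n, (y < k) ==> (arr s tCOV y == 1)].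
    apply/forallP/andP => [h|[h1 /forallP h2] y].
      split; first by have := h z; rewrite ltnSn.
      by apply/forallP => y; apply/implyP => hy; have := h y; rewrite ltnW.
    by rewrite (lt_ordS y (erefl : z = k :> nat)); case: eqP => [->|_] /=; rewrite ?h1 // h2.
  rewrite andbCA -hok {hok hwt}.
  have e1 : eval (setr vY k s2) ((tCOV@[vY] [-] #1) [+] (#1 [-] tCOV@[vY])) == 0 = (arr s tCOV z == 1).
    by rewrite /= /upd /= hcov; case: (arr s tCOV z) => [|[|a]].
  set s3 := exec (when ((tCOV@[vY] [-] #1) [+] (#1 [-] tCOV@[vY])) (vOk <~ #0)) (setr vY k s2).
  have o3 : (reg s3 vOk != 0) = (arr s tCOV z == 1) && (reg s2 vOk != 0).
    by rewrite /s3 exec_when e1; case: (_ == 1).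
  have w3 : reg s3 vWt = reg s2 vWt by rewrite (exec_frame _ (setr vY k s2)).1.
  have a3 : arr s3 = arr s2 by rewrite /s3 exec_when; case: ifP.
  have y3 : reg s3 vY = z by rewrite (exec_frame _ (setr vY k s2)).1.
  have -> : exec c (setr vY k s2) = exec (when tDD@[vY] (vWt <~ vWt [+] tIN@[vY])) s3 by [].
  rewrite exec_when [eval _ _](_ : _ = arr s2 tDD z); last by rewrite /= y3 a3.
  rewrite hd; case: (z \in D) => /=; rewrite /upd /=; split=> //.
    by rewrite y3 a3 hw w3 addnC.
rewrite eval_var hn in hok hwt hc; split.
- by rewrite hok; congr (_ && _); apply: eq_forallb => y; rewrite ltn_ord.
- rewrite hwt /weight [RHS]big_mkcond; apply: eq_bigl => y; exact: ltn_ord.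
- by rewrite hcE.
Qed.

Lemma cost_if e c1 c2 s : cost (CIf e c1 c2) s =
  esize e + 1 + (if eval s e == 0 then cost c2 s else cost c1 s + 1).
Proof. by []. Qed.

Lemma p_record_ok s (s' := exec p_record s) : has_graph E w s ->
  (if (reg s vOk != 0) && ((reg s vHas == 0) || (reg s vWt < reg s vBW)) then
     [/\ reg s' vHas = 1, reg s' vBW = reg s vWt & forall y : 'I_n, arr s' tBEST y = arr s tDD y]
   else [/\ reg s' vHas = reg s vHas, reg s' vBW = reg s vBW & arr s' tBEST = arr s tBEST]) /\
  cost p_record s <= max_cost p_record * n.+1.
Proof.
rewrite {}/s' => hg; have hn : reg s vN = n by case: hg => -[].
set c1 := CIf vHas (vF <~ vBW [-] vWt) (vF <~ #1).
set cp := CFor vY vN (tBEST@@[vY] <~ tDD@[vY]).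
set c2 := (vHas <~ #1;; vBW <~ vWt);; cp.
have -> : p_record = when vOk (c1;; when vF c2) by [].
set K := max_cost (when _ _).
have K1 : K = max_cost c1 + max_cost cp + 14 by [].
have K2 : 14 <= K by [].
have hcost t : t <= K -> t <= K * n.+1 by move=> h; apply: leq_trans h _; rewrite leq_pmulr.
rewrite exec_when cost_when eval_var; case: eqP => [_|ok].
  by split=> //; apply: (hcost _); move: (K) K2 => K' K2'; rewrite /=; lia.
rewrite exec_seq cost_seq exec_when cost_when; set s1 := exec c1 s.
have fr1 : frame c1 s s1 := exec_frame c1 s.
have hF : (eval s1 vF == 0) = ~~ ((reg s vHas == 0) || (reg s vWt < reg s vBW)).
  rewrite /s1 /= /upd /= negb_or; case: (reg s vHas) => [|h] //=.
  by rewrite /upd /= subn_eq0 leqNgt.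
have hc1 := @cost_loop_free c1 s isT.
rewrite andTb; move: hF; case: (_ || _) => hF; rewrite hF [~~ _]/=; last first.
  split; first by split; [rewrite -[RHS]fr1.1 | rewrite -[RHS]fr1.1 | rewrite -[RHS]fr1.2].
  by apply: (hcost _); move: (K) (cost c1 s) (max_cost c1) (max_cost cp) K2 K1 hc1 => ? ? ? ?; rewrite /=; lia.
rewrite exec_seq cost_seq; set s2 := exec (vHas <~ #1;; vBW <~ vWt) s1.
have hn2 : reg s2 vN = n by rewrite /s2 /= /upd /= fr1.1.
have fr3 : frame cp s2 (exec cp s2) := exec_frame cp s2.
have [||hJ hc] := @for_loop_free vY vN (tBEST@@[vY] <~ tDD@[vY]) s2 (fun k s3 =>
  forall y : 'I_n, y < k -> arr s3 tBEST y = arr s tDD y) isT.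
- by [].
- move=> k s3; rewrite eval_var hn2 => hk fr ih y; rewrite ltnS leq_eqVlt /= /upd /=.
  by case: eqP => [->|_] /=; [rewrite fr.2 // /s2 /= fr1.2 | apply: ih].
rewrite eval_var hn2 -/cp in hJ hc; split.
  split; [by rewrite fr3.1 | by rewrite fr3.1 // /s2 /= /upd /= fr1.1 | by move=> y; apply: hJ].
have hs2 : cost (vHas <~ #1;; vBW <~ vWt) s1 = 4 by [].
by move: (K) (cost c1 s) (max_cost c1) (max_cost cp) (cost cp s2) K2 K1 hc hc1 hs2 => ? ? ? ? ?; rewrite /=; nia.
Qed.

Definition best s := [set y : 'I_n | arr s tBEST y != 0].

Definition sound s :=
  (reg s vTwo != 0 -> has_induced_P2P4 E) /\
  (reg s vHas != 0 -> efficient_dom E (best s) /\ weight w (best s) = reg s vBW).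

(** [D] is settled: either an induced P2 + P4 has been flagged, or a candidate at most as heavy is
    recorded. Once settled, a set stays settled. *)
Definition covered s D := reg s vTwo != 0 \/ reg s vHas != 0 /\ reg s vBW <= weight w D.

Definition test_const :=
  max_cost p_init_test + 4 * max_cost p_cover + max_cost p_check + max_cost p_record + 100.

(** The test settles every e.d. containing both [v] and [d], whichever path was supplied. *)
Lemma p_test_ok s (v u x d : 'I_n) (s' := exec p_test s) : has_graph E w s ->
  reg s vV = v -> reg s vU = u -> reg s vX = x -> reg s vD = d -> p4 E v u x d -> sound s ->
  [/\ sound s', forall D, covered s D -> covered s' D,
     forall D, efficient_dom E D -> v \in D -> d \in D -> covered s' D &
     cost p_test s <= test_const * n.+1].
Proof.
rewrite {}/s' => hg hv hu hx hd hp hs; rewrite /p_test 5!exec_seq.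
set Z := far E v u x d; pose D0 := v |: (d |: Z).
have [init cinit] := p_init_test_ok hg hv hu hx hd.
have fr1 := exec_frame p_init_test s; set s1 := exec p_init_test s in init fr1 *.
set c2 := (tDD@@[vV] <~ #1;; _); have fr2 := exec_frame c2 s1; have cc2 := @cost_loop_free c2 s1 isT.
set s2 := exec c2 s1 in fr2 *.
have hg2 : has_graph E w s2 by apply: (has_graph_frame fr2) => //; apply: (has_graph_frame fr1) => //.
have hZ2 (y : 'I_n) : arr s2 tZ y = (y \in Z) by rewrite fr2.2 //; case: (init y).
have hD2 (y : 'I_n) : (arr s2 tDD y != 0) = (y \in D0).
  rewrite /s2 /= /upd /= fr1.1 // fr1.1 // hv hd !in_setU1.
  rewrite -[(y : nat) == d]/(y == d) -[(y : nat) == v]/(y == v).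
  case: (init y) => _ -> _; case: (y == d); case: (y == v) => //=.
  by rewrite -/Z; case: (y \in Z).
have hcov2 (y : 'I_n) : arr s2 tCOV y = 0 by rewrite fr2.2 //; case: (init y).
have hsum2 : reg s2 vSum = 0 by [].
have [P [[PD Psum PDn] Pcov Ptwo ccov]] := p_cover_ok simpleE hg2 hZ2 hD2 hcov2 hsum2.
have fr3 := exec_frame p_cover s2; set s3 := exec p_cover s2 in Psum PDn Pcov Ptwo fr3 *.
set c4 := (vOk <~ _;; _); have fr4 := exec_frame c4 s3; have cc4 := @cost_loop_free c4 s3 isT.
set s4 := exec c4 s3 in fr4 *.
have hg4 : has_graph E w s4.
  by apply: (has_graph_frame fr4) => //; apply: (has_graph_frame fr3).
have hD4 (y : 'I_n) : (arr s4 tDD y != 0) = (y \in D0) by rewrite fr4.2 // fr3.2.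
have [ok5 wt5 ccheck] := p_check_ok hg4 hD4 (erefl _).
have fr5 := exec_frame p_check s4; set s5 := exec p_check s4 in ok5 wt5 fr5 *.
have fr : frame (p_init_test;; c2;; p_cover;; c4;; p_check) s s5 := exec_frame _ s.
have hg5 : has_graph E w s5 by apply: (has_graph_frame fr).
have [hrec crec] := p_record_ok hg5.
have fr6 := exec_frame p_record s5; set s6 := exec p_record s5 in hrec fr6 *.
have hn3 : reg s3 vN = n by rewrite fr3.1 //; case: hg2 => -[].
have {}ok5 : (reg s5 vOk != 0) = (reg s3 vSum <= n) && [forall y, \sum_(z in P) dominates E z y == 1].
  rewrite ok5 -lt0n {1}/s4 /= /upd /= hn3 subn_gt0 addn1 ltnS; congr (_ && _).
  by apply: eq_forallb => y; rewrite -Pcov.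
rewrite {}ok5 {}wt5 !fr.1 // in hrec.
have two6 : reg s6 vTwo = reg s3 vTwo by rewrite fr6.1 // fr5.1 // fr4.1.
have two2 : reg s2 vTwo = reg s vTwo by rewrite fr2.1 // fr1.1.
rewrite two2 -two6 in Ptwo.
(* A visited vertex with a neighbour in [Z] is neither [v] nor [d], which dominate nothing in [Z];
   so the edge lies inside [Z]. *)
have two_ok : reg s6 vTwo != 0 -> has_induced_P2P4 E.
  case: Ptwo => -[-> h]; first exact: hs.1.
  move=> _; have [z [y [zD yZ zy]]] := h; apply: (far_edge simpleE hp _ yZ zy).
  move: zD yZ; rewrite !in_setU1 => /or3P[/eqP ez|/eqP ez|//]; rewrite ez in zy.
    by rewrite inE (adj_dom zy).
  by rewrite inE (adj_dom zy) !orbT.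
pose accept := (reg s3 vSum <= n) && [forall y, \sum_(z in P) dominates E z y == 1].
(* With the sum at most n, [P] is all of [D0], and the counts say that each vertex is dominated
   exactly once. *)
have acceptD : accept -> efficient_dom E D0.
  case/andP=> /PDn <- /forallP h y; rewrite -(eqP (h y)) -sum1_card [LHS]big_mkcond [RHS]big_mkcond.
  by apply: eq_bigr => z _; rewrite inE; case: (z \in P) => //=; case: (dominates E z y).
(* Visited vertices without neighbour in [Z] all belong to [D]; by [ed_sum] their sum is at most n,
   so nothing was skipped and [D0] is contained in [D]. The converse inclusion is [ed_sub_far]. *)
have forced D : efficient_dom E D -> v \in D -> d \in D ->
    (forall z y, z \in P -> y \in Z -> ~~ adj E z y) -> accept /\ D = D0.
  move=> hD vD dD hP.
  have PsD : P \subset D.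
    apply/subsetP => z zP; apply: (isolated_in_ed hp hD vD dD); first exact: (subsetP PD).
    by move=> y; apply: hP.
  have hsum : reg s3 vSum <= n.
    rewrite Psum -[X in _ <= X](ed_sum simpleE hD); apply: sub_le_big => //=; first by move=> *; apply: leq_addr.
    by move=> z; apply: (subsetP PsD).
  have PE := PDn hsum.
  have DE : D = D0 by apply/eqP; rewrite eqEsubset -{2}PE PsD (ed_sub_far hp hD vD dD).
  split=> //; rewrite /accept hsum; apply/forallP => y; rewrite PE -DE.
  apply/eqP; rewrite -(hD y) -sum1_card [LHS]big_mkcond [RHS]big_mkcond.
  by apply: eq_bigr => z _; rewrite inE; case: (z \in D) => //=; case: (dominates E z y).
have hDD5 (y : 'I_n) : (arr s5 tDD y != 0) = (y \in D0) by rewrite fr5.2 // hD4.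
rewrite -/accept in hrec.
split.
- split=> //; move: hrec; case: ifP => [/andP[ha _] [h1 h2 h3] _|_ [-> -> hb]].
    have -> : best s6 = D0 by apply/setP=> y; rewrite inE h3 hDD5.
    by split; [apply: acceptD | rewrite h2].
  rewrite (_ : best s6 = best s); first exact: hs.2.
  by apply/setP => y; rewrite !inE hb fr.2.
- move=> D [h|[h1 h2]]; first by left; case: Ptwo => -[-> //].
  right; move: hrec; case: ifP => [/andP[_ /orP[/eqP h|h]] [-> -> _]|_ [-> -> _]] //.
    by rewrite h in h1.
  by split=> //; apply: leq_trans h2; apply: ltnW.
- move=> D hD vD dD; case: Ptwo => -[h1 h2]; last by left; rewrite h1.
  have [ha ->] := forced D hD vD dD h2; right.
  move: hrec; rewrite ha andTb; case: ifP => [_ [-> -> _]|/negbT] //.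
  by rewrite negb_or -leqNgt => /andP[h3 h4] [-> -> _].
- rewrite -/p_test (_ : cost p_test s = cost p_init_test s + (cost c2 s1 + (cost p_cover s2 +
    (cost c4 s3 + (cost p_check s4 + cost p_record s5))))) //.
  have mc2 : max_cost c2 <= 50 by [].
  have mc4 : max_cost c4 <= 50 by [].
  rewrite /test_const; move: (max_cost p_init_test) (max_cost p_cover) (max_cost p_check) (max_cost p_record)
    (max_cost c2) (max_cost c4) cinit ccov ccheck crec cc2 cc4 mc2 mc4 => K1 K2 K3 K4 K5 K6.
  move: (cost p_init_test s) (cost c2 s1) (cost p_cover s2) (cost c4 s3) (cost p_check s4) (cost p_record s5).
  move=> *; nia.
Qed.

End Search.

Lemma when_false e c s : eval s e = 0 ->
  exec (when e c) s = setr vNull 0 s /\ cost (when e c) s = esize e + 3.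
Proof. by move=> h; rewrite exec_when cost_when h eqxx -addnA. Qed.

Lemma when_true e c s : eval s e != 0 ->
  exec (when e c) s = exec c s /\ cost (when e c) s = esize e + 2 + cost c s.
Proof. by move=> h; rewrite exec_when cost_when ifN // ifN //; split=> //; lia. Qed.

Section Nonuniversal.
Variables (n : nat) (E : edge_list n) (w : 'I_n -> nat).
Hypothesis simpleE : simple_edges E.

Definition search_const := test_const + 100.

(** The cost is O(n) per vertex [d] with a [tP3] entry, plus O(n) for the loop itself; the entries
    stay fixed during the loop, so they may be counted in the initial state. *)
Lemma p_search_ok s (v : 'I_n) (s' := exec p_search s) : has_graph E w s ->
  reg s vV = v -> witness E E (exits E v) (arr s tP2) -> witness E E (to_level3 E v) (arr s tP3) ->
  sound E w s ->
  [/\ sound E w s', forall D, covered w s D -> covered w s' D,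
     forall D (d : 'I_n), efficient_dom E D -> v \in D -> d \in D -> arr s tP3 d != 0 -> covered w s' D &
     cost p_search s <= search_const * (n.+1 * (\sum_(d : 'I_n) (arr s tP3 d != 0)).+1)].
Proof.
rewrite {}/s' => hg hv h2 h3 hs.
have testP := @p_test_ok n E w simpleE; rewrite /search_const; move: test_const testP => KT testP.
have hn : reg s vN = n by case: hg => -[].
set c := (vX <~ tP3@[vD] [-] #1;; vU <~ tP2@[vX] [-] #1).
set body := when tP3@[vD] (c;; p_test).
have -> : p_search = CFor vD vN body by [].
have := @for_rule vD vN body s (fun k t s2 =>
  [/\ sound E w s2, forall D, covered w s D -> covered w s2 D,
     forall D (d : 'I_n), efficient_dom E D -> v \in D -> d \in D -> d < k ->
       arr s tP3 d != 0 -> covered w s2 D &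
     t <= (KT + 30) * (k + n.+1 * \sum_(d : 'I_n | d < k) (arr s tP3 d != 0))]).
case.
- by split.
- move=> k t s2; rewrite eval_var hn => hk fr [sd mono cov ht]; pose d := Ordinal hk.
  set s3 := setr vD k s2.
  have hg2 : has_graph E w s2 by apply: (has_graph_frame fr).
  have hg3 : has_graph E w s3 by apply: has_graph_setr.
  have p3E : arr s2 tP3 = arr s tP3 by rewrite fr.2.
  have p2E : arr s2 tP2 = arr s tP2 by rewrite fr.2.
  have e1 : eval s3 (tP3@[vD]) = arr s tP3 d by rewrite -p3E.
  rewrite (sum_ltS _ (erefl : d = k :> nat)) exec_when cost_when e1 [esize _]/=.
  case: eqP => [d0|/eqP d0].
    split=> //.
    + move=> D y hD vD yD; rewrite (lt_ordS y (erefl : d = k :> nat)) => /orP[/eqP->|yk]; first by rewrite d0.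
      exact: cov.
    + by move: ht; move: (\sum_(_ | _) _) => S; nia.
  have [[e _]|[x [x1 xd lx]]] := h3 d; first by rewrite e in d0.
  have /and3P[l2x vd nl2d] := lx.
  (* A missing entry is impossible, because [x] is at distance 2 and has a common neighbour with
     [v]. *)
  have [u [u1 ux ex]] : exists u : 'I_n, [/\ arr s tP2 x = u.+1, adj E u x & exits E v u x].
    case: (h2 x) => // -[_ hu]; case/andP: l2x => vx /existsP[u /andP[vu ux]].
    by have := hu u ux; rewrite /exits vx adj_dom.
  have hp : p4 E v u x d by case/andP: ex => vu vx; apply: p4I.
  set s4 := exec c s3.
  have fr4 : frame c s3 s4 := exec_frame c s3.
  have hg4 : has_graph E w s4 by apply: (has_graph_frame fr4).
  have x4 : reg s4 vX = x.
    have e0 : arr s2 tP3 k = x.+1 by rewrite p3E -x1.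
    by rewrite /s4 /= /upd /= e0 subn1.
  have u4 : reg s4 vU = u.
    have e0 : arr s2 tP3 k = x.+1 by rewrite p3E -x1.
    have e7 : arr s2 tP2 (arr s2 tP3 k - 1) = u.+1 by rewrite e0 subn1 p2E.
    by rewrite /s4 /= /upd /= e7 subn1.
  have v4 : reg s4 vV = v by rewrite fr4.1 // -hv -fr.1.
  have d4 : reg s4 vD = d by rewrite fr4.1.
  have s4E : sound E w s4 by exact: sd.
  have [sd5 mono5 cov5 c5] := testP s4 v u x d hg4 v4 u4 x4 d4 hp s4E.
  rewrite exec_seq -/s4; split=> //.
  + by move=> D /mono h; apply: mono5.
  + move=> D y hD vD yD; rewrite (lt_ordS y (erefl : d = k :> nat)) => /orP[/eqP ey|yk] hy.
      by apply: cov5 => //; rewrite -ey.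
    by apply: mono5; apply: (cov D y hD vD yD yk hy).
  + rewrite cost_seq -/s4 (_ : cost c s3 = 24) // [~~ false]/=.
    by move: ht c5; move: (\sum_(_ | _) _) (cost p_test s4) => S T; nia.
rewrite eval_var hn => t [[sd mono cov ht] ->]; split=> //.
  by move=> D d hD vD dD; apply: cov.
have -> : \sum_(d : 'I_n) (arr s tP3 d != 0 : nat) = \sum_(d : 'I_n | d < n) (arr s tP3 d != 0).
  by apply: eq_bigl => y; rewrite ltn_ord.
by move: ht; move: (\sum_(_ | _) _) => S; rewrite [esize _]/=; nia.
Qed.

Definition out s := [set y : 'I_n | arr s tOUT y.+1 != 0].

Definition solved s :=
  [\/ arr s tOUT 0 = 0 /\ efficient_dom E (out s) /\
        (forall D : {set 'I_n}, efficient_dom E D -> weight w (out s) <= weight w D),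
      arr s tOUT 0 = 1 /\ (forall D : {set 'I_n}, ~ efficient_dom E D)
    | arr s tOUT 0 = 2 /\ has_induced_P2P4 E].

(** Being good is constant along edges and [d] is reached from [wv] by edges; hence at most as many
    [d] are tested as there are non-good vertices. *)
Lemma to_level3_nongood (v wv d : 'I_n) (R : nat -> nat) : witness E E (to_level3 E v) R ->
  dominates E wv v -> ~~ good E wv -> R d != 0 -> ~~ good E d.
Proof.
move=> h3 wvv ng; case: (h3 d) => [[-> //]|[x [_ xd /and3P[l2 _ _]]]] _.
have [_ /existsP[u /andP[vu ux]]] := andP l2.
rewrite (good_closed xd) (good_closed ux) (good_closed vu).
by case: (altP (wv =P v)) wvv => [<-//|ne /(dom_adj ne) a]; rewrite (good_closed a).
Qed.

Definition nonuniversal_const := 20 * (max_cost p_levels + search_const + 100).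

(** Any e.d. has a member [v] in the closed neighbourhood of [wv]. As [wv] is not good, [v] is not
    full, so [ed_level3] supplies a [d] for which the pair is tested, and the e.d. gets settled. *)
Lemma p_nonuniversal_ok s (wv : 'I_n) (s' := exec p_nonuniversal s) : has_graph E w s ->
  reg s vW = wv -> ~~ good E wv -> (forall y, ~~ good E y -> degree E wv <= degree E y) ->
  arr s tOUT 0 = 0 -> (forall i, arr s tBEST i = 0) ->
  solved s' /\ cost p_nonuniversal s <= nonuniversal_const * (n.+1 * (size E).+1).
Proof.
rewrite {}/s' => hg hw ng hmin ho hb; have searchP := p_search_ok.
rewrite /nonuniversal_const; move: search_const searchP => KS searchP.
set KL := max_cost p_levels; rewrite /p_nonuniversal.
set c0 := (vTwo <~ #0;; _); set body := when (closed_nb vW vV) _; set c3 := CIf vTwo _ _.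
rewrite 2!exec_seq 2!cost_seq; set s0 := exec c0 s.
have fr0 : frame c0 s s0 := exec_frame c0 s.
have hg0 : has_graph E w s0 by apply: (has_graph_frame fr0).
have hn0 : reg s0 vN = n by case: hg0 => -[].
have hw0 : reg s0 vW = wv by rewrite fr0.1.
pose NG := #|[set y | ~~ good E y]|.
(* Cost for one [v]: its levels, then at most [NG] tests of linear cost. It is paid
   [(degree E wv).+1] times. *)
pose B := KL * (n + size E).+1 + KS * (n.+1 * NG.+1).
have sound0 : sound E w s0 by split.
have := @for_rule vV vN body s0 (fun k t s2 =>
  [/\ sound E w s2,
     forall D (v : 'I_n), efficient_dom E D -> v \in D -> dominates E wv v -> v < k -> covered w s2 D &
     t <= 50 * k + B * \sum_(v : 'I_n | v < k) dominates E wv v]).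
case.
- by split.
- move=> k t s2; rewrite eval_var hn0 => hk fr [sd cov ht]; pose v := Ordinal hk.
  set s3 := setr vV k s2.
  have hg2 : has_graph E w s2 by apply: (has_graph_frame fr).
  have hg3 : has_graph E w s3 by apply: has_graph_setr.
  have hw3 : reg s3 vW = wv by rewrite -hw0 -fr.1.
  rewrite (sum_ltS _ (erefl : v = k :> nat)).
  have e1 := eval_closed_nb (b := v) (y := vV) hg3 hw3 (erefl _).
  have Kd : esize (closed_nb vW vV) = 19 by [].
  case: (boolP (dominates E wv v)) => wvv; rewrite ?wvv ?(negbTE wvv) in e1; last first.
    have [-> ->] := when_false (p_levels;; p_search) e1; split=> //.
      move=> D y hD yD wy; rewrite (lt_ordS y (erefl : v = k :> nat)) => /orP[/eqP ey|yk].
        by move: wvv; rewrite -ey wy.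
      exact: (cov D y).
    by rewrite Kd; move: ht; rewrite add0n; lia.
  have [|-> ->] := @when_true (closed_nb vW vV) (p_levels;; p_search) s3; first by rewrite e1.
  rewrite exec_seq cost_seq Kd.
  have [h2 h3 clev] := p_levels_ok simpleE hg3 (erefl (reg s3 vV) : reg s3 vV = v).
  have fr4 : frame p_levels s3 (exec p_levels s3) := exec_frame _ s3.
  set s4 := exec p_levels s3 in h2 h3 fr4 *.
  have hg4 : has_graph E w s4 by apply: (has_graph_frame fr4).
  have v4 : reg s4 vV = v by rewrite fr4.1.
  have r4 x : x \in [:: vTwo; vHas; vBW] -> reg s4 x = reg s2 x.
    by rewrite !inE => /or3P[] /eqP->; rewrite fr4.1.
  have b4 : arr s4 tBEST = arr s2 tBEST by rewrite fr4.2.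
  have sd4 : sound E w s4 by rewrite /sound /best b4 !r4.
  have cov4 D : covered w s2 D -> covered w s4 D by rewrite /covered !r4.
  have [sd5 mono5 cov5 c5] := searchP s4 v hg4 v4 h2 h3 sd4.
  split=> //.
  - move=> D y hD yD wy; rewrite (lt_ordS y (erefl : v = k :> nat)) => /orP[/eqP ey|yk]; last first.
      by apply/mono5/cov4/(cov D y).
    have vD : v \in D by rewrite -ey.
    have nf : ~~ full E v.
      by apply: contra ng => fv; apply/existsP; exists v; rewrite fv domC.
    have [x [d [dD l2 xd vd nl]]] := ed_level3 hD vD nf.
    apply: (cov5 D d) => //; rewrite (witnessP d h3); apply/existsP; exists x.
    by rewrite xd /to_level3 l2 vd.
  - have : \sum_(d : 'I_n) (arr s4 tP3 d != 0) <= NG.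
      rewrite /NG -sum1_card [X in _ <= X]big_mkcond; apply: leq_sum => d _.
      by rewrite inE; case: eqP => [//|/eqP h]; rewrite (to_level3_nongood h3 wvv ng h).
    rewrite mulnDr muln1.
    move: ht clev c5; rewrite /B -/KL; move: (\sum_(_ | _) _) (\sum_(_ < _) _) (cost _ _) (cost _ _) => S S' C C'.
    move=> ht clev c5 hS.
    have : KS * (n.+1 * S'.+1) <= KS * (n.+1 * NG.+1) by rewrite !leq_mul2l ltnS hS !orbT.
    by move: ht clev c5; move: (KS * _) (KS * _) (KL * _) (_ * S) => *; lia.
rewrite eval_var hn0 => t [[sd cov ht] hc].
set s1 := exec (CFor vV vN body) s0 in sd cov *.
have fr1 : frame (CFor vV vN body) s0 s1 := exec_frame _ s0.
have o1 : arr s1 tOUT 0 = 0 by rewrite fr1.2.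
have hn1 : reg s1 vN = n by rewrite fr1.1.
have cov1 D : efficient_dom E D -> covered w s1 D.
  move=> hD; have [v vD vw] := ed_ex wv hD.
  by apply: (cov D v hD vD _ (ltn_ord v)); rewrite domC.
have hdeg : \sum_(v : 'I_n | v < n) dominates E wv v = (degree E wv).+1.
  rewrite -card_dom // -sum1_card [RHS]big_mkcond; apply: eq_big => [v|v _]; first exact: ltn_ord.
  by rewrite inE; case: (dominates _ _ _).
set cp := CFor vY vN (tOUT@@[vY [+] #1] <~ tBEST@[vY]).
have [||[out0 outS] ccp] := @for_loop_free vY vN (tOUT@@[vY [+] #1] <~ tBEST@[vY]) s1 (fun k s2 =>
  arr s2 tOUT 0 = 0 /\ forall y : 'I_n, y < k -> arr s2 tOUT y.+1 = arr s1 tBEST y) isT.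
- by [].
- move=> k s2 _ fr [h0 ih]; rewrite /= /upd /= addn1 /=; split=> // y.
  rewrite ltnS leq_eqVlt eqSS; case: eqP => [->|_] /=; [by rewrite fr.2 | exact: ih].
rewrite eval_var hn1 -/cp in outS ccp.
have c3E : exec c3 s1 = if reg s1 vTwo == 0 then if reg s1 vHas == 0 then seta tOUT 0 1 s1 else exec cp s1
    else seta tOUT 0 2 s1 by [].
split.
  rewrite c3E; case: eqP => [two0|/eqP two1]; last by constructor 3; split=> //; apply: sd.1.
  case: eqP => [has0|/eqP has1].
    constructor 2; split=> // D /cov1; rewrite /covered two0 has0; by case=> [//|[]].
  constructor 1; split; first exact: out0.
  have -> : out (exec cp s1) = best n s1 by apply/setP=> y; rewrite !inE outS.
  have [edb hbw] := sd.2 has1; split=> // D /cov1.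
  by rewrite /covered two0 hbw => -[//|[]].
have cc3 : cost c3 s1 <= 40 + cost cp s1.
  have e1 : cost (tOUT@@[#0] <~ #1) s1 = 10 by [].
  have e2 : cost (tOUT@@[#0] <~ #2) s1 = 10 by [].
  have [e3 e4] : esize vTwo = 1 /\ esize vHas = 1 by [].
  rewrite /c3 !cost_if -/cp e1 e2 e3 e4.
  by case: ifP => _; [case: ifP => _|]; lia.
have c0E : cost c0 s = 6 by [].
have cpE : max_cost cp = 30 by [].
have hmb := min_degree_bound simpleE ng hmin.
have dn := degree_lt wv simpleE.
have dm : degree E wv <= 2 * size E.
  by rewrite -sum_degree (bigD1 wv) //= leq_addr.
rewrite hc c0E; rewrite hdeg in ht; rewrite cpE in ccp.
move: hmb dn dm ht ccp cc3; rewrite /B -/NG [esize _]/=.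
move: (cost c3 s1) (cost cp s1) (degree E wv) (size E) (NG) (KL) => C3 CP dg m G L hmb dn dm ht ccp cc3.
(* The part with n uses [dg <= 2 * m], the part with m uses [dg < n]. *)
have h1 : (n + m).+1 * dg.+1 <= 3 * (n.+1 * m.+1) by move: dn dm; clear; nia.
have h2 : G.+1 * dg.+1 <= 6 * m.+1 by move: hmb dm; clear; nia.
have h3 : L * (n + m).+1 * dg.+1 <= 3 * L * (n.+1 * m.+1).
  by rewrite (mulnC 3) -!mulnA leq_mul2l h1 orbT.
have h4 : KS * (n.+1 * G.+1) * dg.+1 <= 6 * KS * (n.+1 * m.+1).
  rewrite (mulnC 6) -!mulnA leq_mul2l; apply/orP; right.
  by rewrite (mulnCA 6) leq_mul2l h2 orbT.
have h5 : t <= 50 * n + 3 * L * (n.+1 * m.+1) + 6 * KS * (n.+1 * m.+1).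
  by apply: leq_trans ht _; rewrite mulnDl -addnA leq_add2l leq_add.
have h6 : n.+1 <= n.+1 * m.+1 by rewrite leq_pmulr.
move: h5 h6; move: (n.+1 * m.+1) => X h5 h6.
have -> : 20 * (L + KS + 100) * X = 20 * (L * X) + 20 * (KS * X) + 2000 * X by clear; nia.
move: h5; rewrite -!mulnA; move: (L * X) (KS * X) => *; lia.
Qed.

End Nonuniversal.

Lemma size_flatten_edges n (E : edge_list n) :
  size (flatten [seq [:: nat_of_ord e.1; nat_of_ord e.2] | e <- E]) = size E + size E.
Proof. by elim: E => //= e E ->; rewrite addnS. Qed.

Lemma encode_edges n (E p r : edge_list n) (e : 'I_n * 'I_n) (w : 'I_n -> nat) : E = p ++ e :: r ->
  encode E w (n + (size p + size p) + 2) = e.1 /\ encode E w (n + (size p + size p) + 1 + 2) = e.2.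
Proof.
move=> hE; have enc i : encode E w (n + i + 2) = nth 0 (flatten [seq [:: val e.1; val e.2] | e <- E]) i.
  rewrite /encode /input_list addn2 /= nth_cat size_map size_enum_ord.
  by rewrite ltnNge leq_addr addKn.
rewrite -(addnA n _ 1) !enc hE map_cat flatten_cat !nth_cat size_flatten_edges.
split; first by rewrite ltnn subnn.
by rewrite addn1 ltnNge leqnSn subSnn.
Qed.

Lemma encode_weight n (E : edge_list n) (w : 'I_n -> nat) (v : 'I_n) : encode E w (v + 2) = w v.
Proof.
rewrite /encode /input_list addn2 /= nth_cat size_map size_enum_ord ltn_ord.
by rewrite (nth_map v) ?size_enum_ord // nth_ord_enum.
Qed.

Lemma encode_default n (E : edge_list n) (w : 'I_n -> nat) i :
  n + 2 * size E + 2 <= i -> encode E w i = 0.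
Proof.
move=> hi; rewrite /encode nth_default // /input_list !size_cat size_map size_enum_ord.
by rewrite size_flatten_edges /=; lia.
Qed.

Definition wed_const :=
  100 * max_cost p_count + max_cost p_row + max_cost p_edges + max_cost p_full + max_cost p_good +
  max_cost p_min + max_cost p_universal + nonuniversal_const + 100.

Lemma wed_program_ok n (E : edge_list n) (w : 'I_n -> nat) s : simple_edges E ->
  reg s vN = n -> reg s vS = 96 * n + 64 * size E ->
  arr s = (fun t i => if t == 0 then encode E w (i + 2) else 0) ->
  solved E w (exec wed_program s) /\ cost wed_program s <= wed_const * (n.+1 * (size E).+1).
Proof.
move=> hs hn hS hA.
set c7 := CIf (vN [-] vMin) p_nonuniversal p_universal.
pose s1 := exec p_count s; pose s2 := exec p_row s1; pose s3 := exec p_edges s2.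
pose s4 := exec p_full s3; pose s5 := exec p_good s4; pose s6 := exec p_min s5.
have -> : exec wed_program s = exec c7 s6 by [].
have -> : cost wed_program s = cost p_count s + (cost p_row s1 + (cost p_edges s2 + (cost p_full s3 +
   (cost p_good s4 + (cost p_min s5 + cost c7 s6))))) by [].
have fr1 : frame p_count s s1 := exec_frame _ _.
have fr2 : frame p_row s1 s2 := exec_frame _ _.
have fr3 : frame p_edges s2 s3 := exec_frame _ _.
have fr4 : frame p_full s3 s4 := exec_frame _ _.
have fr5 : frame p_good s4 s5 := exec_frame _ _.
have fr6 : frame p_min s5 s6 := exec_frame _ _.
have [m1 k1] := p_count_ok hn hS.
have a1 t : arr s1 t = arr s t by exact: fr1.2.
have in1 : has_input E w s1.
  split=> //; first by rewrite fr1.1.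
    by move=> v; rewrite a1 hA /= encode_weight.
  by move=> p e r hE; rewrite !a1 hA; have [<- <-] := encode_edges w hE.
have [|row2 cl2 k2] := p_row_ok hs in1; first by move=> i; rewrite a1 hA.
have in2 : has_input E w s2 by apply: (has_input_frame fr2).
have [|g3 k3] := p_edges_ok hs in2 row2 cl2; first by move=> i; rewrite fr2.2 // a1 hA.
have [full4 k4] := p_full_ok hs g3.
have g4 : has_graph E w s4 by apply: (has_graph_frame fr4) g3.
have [|| good5 k5] := p_good_ok hs g4; try by move=> v; case: (full4 v).
have g5 : has_graph E w s5 by apply: (has_graph_frame fr5) g4.
have [min6 k6] := p_min_ok hs g5 good5.
have g6 : has_graph E w s6 by apply: (has_graph_frame fr6) g5.
have n6 : reg s6 vN = n by case: g6 => -[].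
have zero6 t i : t \in [:: tOUT; tBEST] -> arr s6 t i = 0.
  by rewrite !inE => /orP[] /eqP->; rewrite fr6.2 // fr5.2 // fr4.2 // fr3.2 // fr2.2 // a1 hA.
have full6 (v : 'I_n) : arr s6 tFULL v = full E v.
  by rewrite fr6.2 // fr5.2 //; case: (full4 v).
have [sol k7] : solved E w (exec c7 s6) /\
    cost c7 s6 <= 10 + (max_cost p_universal + nonuniversal_const) * (n.+1 * (size E).+1).
  have eE : exec c7 s6 = if n - reg s6 vMin == 0 then exec p_universal s6 else exec p_nonuniversal s6.
    by rewrite -{1}n6.
  have cE : cost c7 s6 <= 10 + (if n - reg s6 vMin == 0 then cost p_universal s6 else cost p_nonuniversal s6).
    rewrite /c7 cost_if (_ : eval s6 _ = n - reg s6 vMin); last by rewrite -{1}n6.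
    rewrite (_ : esize _ = 3) //; case: ifP => _; lia.
  case: min6 => [[hm allgood]|[x [hx hm ng hmin]]].
    rewrite eE; rewrite hm subnn eqxx in cE *.
    have [o0 ed opt k7] := p_universal_ok hs g6 full6 (zero6 tOUT 0 isT) allgood.
    split; first by constructor 1.
    by apply: leq_trans cE _; rewrite leq_add2l mulnDl; apply: leq_trans k7 (leq_addr _ _).
  have nz : (n - reg s6 vMin == 0) = false by rewrite hm subn_eq0 leqNgt degree_lt.
  rewrite eE; rewrite nz in cE *.
  have [sol k7] := p_nonuniversal_ok hs g6 hx ng hmin (zero6 tOUT 0 isT) (fun i => zero6 tBEST i isT).
  by split=> //; apply: leq_trans cE _; rewrite leq_add2l mulnDl; apply: leq_trans k7 (leq_addl _ _).
split=> //.
have hX a : a <= n.+1 \/ a <= (size E).+1 -> a <= n.+1 * (size E).+1.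
  by case=> h; apply: leq_trans h _; rewrite ?leq_pmulr ?leq_pmull.
have kmul K a c : c <= K * a -> a <= n.+1 \/ a <= (size E).+1 -> c <= K * (n.+1 * (size E).+1).
  by move=> hc /hX ha; apply: leq_trans hc _; rewrite leq_mul2l ha orbT.
have {}k1 := kmul _ _ _ k1 (or_intror (leqnn _)).
have {}k2 := kmul _ _ _ k2 (or_introl (leqnn _)).
have {}k3 := kmul _ _ _ k3 (or_intror (leqnn _)).
have {}k5 := kmul _ _ _ k5 (or_intror (leqnn _)).
have {}k6 := kmul _ _ _ k6 (or_introl (leqnn _)).
have hX1 : 1 <= n.+1 * (size E).+1 by [].
move: k1 k2 k3 k4 k5 k6 k7 hX1; move: (n.+1 * (size E).+1) => X.
rewrite /wed_const !mulnDl; rewrite -/s1 -/s2 -/s3 -/s4 -/s5 -/s6.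
move: (100 * max_cost p_count * X) (max_cost p_row * X) (max_cost p_edges * X) (max_cost p_full * X)
  (max_cost p_good * X) (max_cost p_min * X) (max_cost p_universal * X) (nonuniversal_const * X).
move: (cost p_count s) (cost p_row s1) (cost p_edges s2) (cost p_full s3) (cost p_good s4)
  (cost p_min s5) (cost c7 s6) => *; lia.
Qed.

Theorem theorem6 :
  exists (P : program) (c : nat),
    forall (n : nat) (E : edge_list n) (w : 'I_n -> nat),
      simple_edges E ->
      exists M : memory,
        run P (c * ((n + 1) * (size E + 1))) 0 (encode E w) = Some M /\
        robust_WED_output E w M.
Proof.
exists (compile wed_program), (wed_const + 1000) => n E w hs.
rewrite !addn1; move: (wed_const) (@wed_program_ok n E w) => K wedP.
(* For n = 0 the program halts at once, and the unchanged memory already holds the code 0 and the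
   empty set, an e.d. of the empty graph. *)
have [n0|n0] := posnP n.
  have hM : encode E w 0 = 0 by rewrite -[RHS]n0.
  exists (encode E w); split.
    have -> : (K + 1000) * (n.+1 * (size E).+1) = ((K + 1000) * (n.+1 * (size E).+1)).-1.+1.
      by rewrite prednK // muln_gt0 addn_gt0 orbT.
    exact: compile_run0.
  subst n; constructor 1; split=> //; split; first by case.
  by move=> D _; rewrite /weight big1 //; case.
have [s [rn rS ra hrun]] := @compile_run wed_program (encode E w) n (size E) wed_program_wf isT
  (erefl _) (erefl _) n0 (@encode_default n E w).
have [sol hc] := wedP s hs rn rS ra.
have [|M [hM out_M]] := hrun ((K + 1000) * (n.+1 * (size E).+1)).
  have h : n + size E <= n.+1 * (size E).+1 by rewrite mulSn mulnS; lia.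
  by rewrite mulnDl addnC leq_add // leq_mul2l h orbT.
exists M; split=> //.
have hout : out_set n M = out n (exec wed_program s).
  by apply/setP => v; rewrite !inE out_M.
by rewrite /robust_WED_output hout out_M.
Qed.
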